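(* Let $\pi=\pi^{\sqrt2}_{2^{1/4},\,-2^{-1/4}}$ be the Jones representation of Thompson's group $F$ constructed from the Temperley-Lieb-Jones planar algebra with loop parameter $\sqrt2$ and the normalized element $2^{1/4}R_1-2^{-1/4}R_2$, and let $\sigma_F$ be the automorphism of $F$ given by $\sigma_F(g)(x)=1-g(1-x)$. Let $\delta\in\{2\cos(\pi/k): k=4,5,6,\dots\}\cup[2,\infty)$ be arbitrary and consider the representation $\pi^\delta_{a,a}$ of $F$, where $a=(2+2\delta)^{-1/2}$. Then $\pi^\delta_{a,a}$, $\pi$ and $\pi\circ\sigma_F$ are mutually unitarily inequivalent.
   Context: Thompson's group $F$ is the group of orientation preserving piecewise linear homeomorphisms of $[0,1]$ with finitely many breakpoints, all at dyadic rationals, and slopes in $2^{\mathbb Z}$. Equivalently: a binary forest with $n$ roots and $m$ leaves is a planar forest, drawn with roots at the bottom and leaves at the top (numbered from left to right), all of whose branchings are binary; $f\circ g$ is $f$ stacked on top of $g$ (roots of $f$ glued to leaves of $g$); a tree is a forest with one root; $|$ is the trivial tree, $Y$ the tree with two leaves, $\bullet$ is horizontal concatenation. $F$ is the set of classes $\frac ts$ of pairs $(t,s)$ of trees with the same number of leaves, modulo $(t,s)\sim(f\circ t,f\circ s)$, with product $\frac ts\cdot\frac{t'}{s'}=\frac{p\circ t}{q\circ s'}$ whenever $p\circ s=q\circ t'$; $\frac ts$ is the homeomorphism mapping, piecewise affinely and in order, the standard dyadic partition of $[0,1]$ given by $s$ onto the one given by $t$. With $\sigma$ the reflection of forests in a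 vertical line, $\sigma_F(\frac ts)=\frac{\sigma(t)}{\sigma(s)}$. Temperley-Lieb-Jones category: for $m+n$ even, $\mathrm{Rec}(m,n)$ is the complex span of non-crossing pairings of $m$ points on the bottom and $n$ points on the top of a rectangle; composition is vertical concatenation, each closed loop being replaced by the factor $\delta$; $\dagger$ is the antilinear reflection in a horizontal line; $\bullet$ is horizontal concatenation. One takes the quotient by the kernel of the positive semidefinite forms, so that $\mathrm{Rec}(1,n)$ is a Hilbert space with $\langle x,y\rangle=y^\dagger\circ x\in \mathrm{Rec}(1,1)=\mathbb C$. Jones representation $\pi^\delta_{a,b}$: here $R_1=|\,|$ and $R_2={}^{\cup}_{\cap}$ in $\mathrm{Rec}(2,2)$. For $a,b\in\mathbb C$ with $\delta(|a|^2+|b|^2)+a\bar b+\bar a b=1$ put $R=aR_1+bR_2$; bending its bottom right string up to the top right gives the isometry $\rho=a(|\bullet\cup)+b(\cup\bullet|)\in\mathrm{Rec}(1,3)$. For the forest $f$ with $n$ roots whose only branching is one $Y$ at the $k$-th root set $\Phi(f)=\mathrm{id}_{2k-2}\bullet\rho\bullet\mathrm{id}_{2n-2k}\in\mathrm{Rec}(2n-1,2n+1)$, and extend by $\Phi(f\circ g)=\Phi(f)\circ\Phi(g)$. For a tree $t$ with $n$ leaves let $\mathfrak H_t$ be a copy, indexed by $t$, of the span in $\mathrm{Rec}(1,2n-1)$ of all $\Phi(s)$, $s$ a tree with $n$ leaves. $\mathscr H$ is the completion of the inductive limit of the $\mathfrak H_t$ along the isometries $(t,\xi)\mapsto(f\circ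 t,\Phi(f)\circ\xi)$, and $\pi^\delta_{a,b}$ is the unitary representation on $\mathscr H$ determined by $\pi^\delta_{a,b}(\frac ts)(v,\xi)=(p\circ t,\Phi(q)\circ\xi)$ where $p\circ s=q\circ v$. *)

(* Defs.v *)
From HB Require Import structures.
From mathcomp Require Import all_boot all_order all_algebra.
From mathcomp Require Import complex.
From mathcomp Require Import all_classical all_reals all_analysis.
From mathcomp Require Import ring lra.

Set Implicit Arguments.
Unset Strict Implicit.
Unset Printing Implicit Defensive.

Import Order.TTheory GRing.Theory Num.Theory.
Import numFieldNormedType.Exports.

Local Open Scope classical_set_scope.
Local Open Scope ring_scope.
Local Open Scope complex_scope.

(* A forest is the sequence of its trees, from left to right. *)
Inductive tree := Leaf | Node of tree & tree.

Fixpoint leaves (t : tree) : nat :=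
  if t is Node l r then (leaves l + leaves r)%N else 1%N.

(* [graft f t] is the composition f o t: the i-th root of f is glued to the
   i-th leaf of t.  It is meaningful when [size f = leaves t]. *)
Fixpoint graft (f : seq tree) (t : tree) : tree :=
  if t is Node l r then
    Node (graft (take (leaves l) f) l) (graft (drop (leaves l) f) r)
  else head Leaf f.

(* A decomposition of the tree t, grown on the leaf number k (counted from 0) of
   a forest, into forests with a single branching: the entries are the numbers
   of the leaves which successively branch, the lowest branching first. *)
Fixpoint growth (k : nat) (t : tree) : seq nat :=
  if t is Node l r then k :: growth k l ++ growth (k + leaves l) r else [::].

Fixpoint forest_growth (k : nat) (f : seq tree) : seq nat :=
  if f is t :: f' then growth k t ++ forest_growth (k + leaves t) f'
  else [::].

Section Thompson.
Variable R : realType.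

Definition dyadic (x : R) : Prop :=
  exists (z : int) (n : nat), x = z%:~R / 2 ^+ n.

(* A homeomorphism of [0,1] is represented by its extension to R by the
   identity, so that equality and composition are those of functions R -> R. *)
Record thompson (g : R -> R) : Prop := {
  thompson_out : forall x, x \notin `[0, 1]%R -> g x = x;
  thompson_continuous : continuous g;
  thompson_increasing : {homo g : x y / x < y};
  thompson_piecewise : exists B : seq R,
    (forall c, c \in B -> dyadic c) /\
    forall x y, 0 <= x -> x < y -> y <= 1 ->
      (forall c, c \in B -> ~~ (x < c < y)) ->
      exists (z : int) (d : R), forall u, x <= u <= y -> g u = 2 ^ z * u + d }.

Record thompsonF := ThompsonF {
  thompson_fun :> R -> R;
  thompsonP : thompson thompson_fun }.

Definition flip_fun (g : R -> R) (x : R) : R := 1 - g (1 - x).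

Lemma flip_thompson g : thompson g -> thompson (flip_fun g).
Proof.
case=> gout gcont ginc [B [Bd Bpw]].
have in01 (x : R) : (1 - x \in `[0, 1]%R) = (x \in `[0, 1]%R).
  by rewrite !in_itv /= subr_ge0 lerBlDr lerDl andbC.
split.
- by move=> x xout; rewrite /flip_fun gout ?in01// subKr.
- have subc : continuous (fun x : R => 1 - x).
    by move=> x; apply: cvgB; [exact: cvg_cst|exact: cvg_id].
  move=> x; apply: cvgB; first exact: cvg_cst.
  by apply: (@cvg_comp _ _ _ (fun y => 1 - y) g _ (nbhs (1 - x)));
    [exact: subc|exact: gcont].
- by move=> x y xy; rewrite /flip_fun ltrD2l ltrN2; apply: ginc;
    rewrite ltrD2l ltrN2.
exists [seq 1 - c | c <- B]; split.
  move=> _ /mapP[c /Bd[z [n ->]] ->]; exists (2 ^+ n - z), n.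
  by rewrite intrB rmorphXn/= mulrBl divff// expf_neq0.
move=> x y x0 xy y1 noB.
have [||||z [d gE]] := Bpw (1 - y) (1 - x).
- by rewrite subr_ge0.
- by rewrite ltrD2l ltrN2.
- by rewrite lerBlDr lerDl.
- move=> c cB; apply: contra (noB (1 - c) (map_f _ cB)) => /andP[yc cx].
  by apply/andP; split; lra.
exists z, (1 - d - 2 ^ z) => u /andP[xu uy].
rewrite /flip_fun gE; last by rewrite !lerD2l !lerN2 xu uy.
by ring.
Qed.

Definition sigmaF (g : thompsonF) : thompsonF :=
  ThompsonF (flip_thompson (thompsonP g)).

Fixpoint dyadic_partition (t : tree) (x y : R) : seq (R * R) :=
  if t is Node l r then
    dyadic_partition l x ((x + y) / 2) ++ dyadic_partition r ((x + y) / 2) y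
  else [:: (x, y)].

(* g is the class of the pair (t, s): it maps the i-th interval of the
   partition of s affinely onto the i-th interval of the partition of t *)
Definition is_fraction (g : thompsonF) (t s : tree) : Prop :=
  leaves t = leaves s /\
  forall i, (i < leaves s)%N ->
    let I := nth (0, 0) (dyadic_partition s 0 1) i in
    let J := nth (0, 0) (dyadic_partition t 0 1) i in
    forall u, 0 <= u <= 1 ->
      g (I.1 + u * (I.2 - I.1)) = J.1 + u * (J.2 - J.1).

End Thompson.

(* The boundary points of a rectangle with m points on the bottom (inl) and n
   points on the top (inr), both numbered from left to right, and their order
   along the boundary: bottom from left to right, then top from right to left *)
Definition bpoint (m n : nat) : finType := ('I_m + 'I_n)%type.

Definition bpos m n (p : bpoint m n) : nat :=
  match p with inl i => i | inr j => (m + (n - j.+1))%N end.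

Definition is_ncpairing m n (D : {ffun bpoint m n -> bpoint m n}) : bool :=
  [forall p, (D p != p) && (D (D p) == p)] &&
  [forall p, forall q, ~~ [&& bpos p < bpos q, bpos q < bpos (D p)
                            & bpos (D p) < bpos (D q)]%N].

Record ncpairing m n := NCPairing {
  pairing :> {ffun bpoint m n -> bpoint m n};
  pairingP : is_ncpairing pairing }.

HB.instance Definition _ m n := [isSub for @pairing m n].
HB.instance Definition _ m n := [Finite of ncpairing m n by <:].

(* The graph obtained by stacking E on top of D.  Its vertices are the bottom
   points of D (inl (inl _)), the glued points (inl (inr _)) and the top points
   of E (inr _). *)
Section Stacking.
Variables m k n : nat.

Definition spoint : finType := ('I_m + 'I_k + 'I_n)%type.

Definition lower_point (p : bpoint m k) : spoint := inl p.

Definition upper_point (p : bpoint k n) : spoint :=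
  match p with inl i => inl (inr i) | inr j => inr j end.

Definition outer_point (p : bpoint m n) : spoint :=
  match p with inl i => inl (inl i) | inr j => inr j end.

Variables (E : ncpairing k n) (D : ncpairing m k).

Definition stacked : rel spoint := [rel u v |
  [exists p, (u == lower_point p) && (v == lower_point (D p))] ||
  [exists p, (u == upper_point p) && (v == upper_point (E p))]].

Definition stack_pairing (G : ncpairing m n) : bool :=
  [forall p, connect stacked (outer_point p) (outer_point (G p))].

Definition loops : nat :=
  n_comp stacked [pred u | [forall p, ~~ connect stacked u (outer_point p)]].

End Stacking.

Definition left_point m n m' n' (p : bpoint m n) : bpoint (m + m') (n + n') :=
  match p with inl i => inl (lshift m' i) | inr j => inr (lshift n' j) end.

Definition right_point m n m' n' (p : bpoint m' n') :
    bpoint (m + m') (n + n') :=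
  match p with inl i => inl (rshift m i) | inr j => inr (rshift n j) end.

Definition juxtaposition m n m' n' (D : ncpairing m n) (E : ncpairing m' n')
    (G : ncpairing (m + m') (n + n')) : bool :=
  [forall p, G (left_point m' n' p) == left_point m' n' (D p)] &&
  [forall p, G (right_point m n p) == right_point m n (E p)].

Definition mirror_point m n (p : bpoint m n) : bpoint n m :=
  match p with inl i => inr i | inr j => inl j end.

Definition mirror_image m n (D : ncpairing m n) (G : ncpairing n m) : bool :=
  [forall p, G (mirror_point p) == mirror_point (D p)].

Section Rec.
Variable R : realType.
Local Notation C := R[i].

(* An element of [Rec m n] is given by its coefficients on the diagrams.  The
   quotient by the kernel of the positive semidefinite form is not taken here:
   it takes place when [Rec 1 n] is mapped isometrically to a Hilbert space. *)
Definition Rec (m n : nat) : lmodType C := {ffun ncpairing m n -> C}.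

(* Given D and E there is exactly one G such that [stack_pairing E D G]
   (respectively [juxtaposition D E G], [mirror_image D G]). *)
Definition rcomp (delta : R) m k n (x : Rec k n) (y : Rec m k) : Rec m n :=
  [ffun G => \sum_E \sum_(D | stack_pairing E D G)
               delta%:C ^+ loops E D * x E * y D].

Definition rtensor m n m' n' (x : Rec m n) (y : Rec m' n') :
    Rec (m + m') (n + n') :=
  [ffun G => \sum_D \sum_(E | juxtaposition D E G) x D * y E].

Definition rdagger m n (x : Rec m n) : Rec n m :=
  [ffun G => \sum_(D | mirror_image D G) Num.conj (x D)].

Definition rid n : Rec n n :=
  [ffun D : ncpairing n n => [forall i, D (inl i) == inr i]%:R].

(* [ncpairing 0 2] and [ncpairing 1 1] both have exactly one element. *)
Definition rcup : Rec 0 2 := [ffun=> 1].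

Definition rscalar (x : Rec 1 1) : C := \sum_D x D.

Definition rdot (delta : R) n (x y : Rec 1 n) : C :=
  rscalar (rcomp delta (rdagger y) x).

(* change of type along equalities of the dimensions; 0 if they differ *)
Definition rconform m n m' n' (x : Rec m n) : Rec m' n' :=
  match m =P m', n =P n' with
  | ReflectT em, ReflectT en =>
      ecast i (Rec i n') em (ecast j (Rec m j) en x)
  | _, _ => 0
  end.

Variables (delta : R) (a b : C).

Definition rho : Rec 1 3 :=
  a *: (rtensor (rid 1) rcup : Rec 1 3) + b *: (rtensor rcup (rid 1) : Rec 1 3).

Definition strands (n : nat) : nat := n.*2.-1.

(* the image of the forest with n roots whose only branching is at the root
   number k < n, counted from 0 *)
Definition Phi_branching (n k : nat) : Rec (strands n) (strands n.+1) :=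
  rconform _ _ (rtensor (rtensor (rid k.*2) rho) (rid (n - k.+1).*2)).

Fixpoint Phi_growth (n m : nat) (w : seq nat) : Rec (strands n) (strands m) :=
  if w is k :: w' then
    rcomp delta (Phi_growth n.+1 m w') (Phi_branching n k)
  else rconform _ _ (rid (strands n)).

(* Phi f for a forest f with n roots and m leaves: the value forced by
   functoriality, computed along the decomposition of f into forests with one
   branching given by forest_growth (two such decompositions differ by exchanges
   of branchings at distinct positions, whose images commute) *)
Definition Phi (n m : nat) (f : seq tree) : Rec (strands n) (strands m) :=
  Phi_growth n m (forest_growth 0 f).

(* the span of the Phi s, for s a tree with n leaves: the common space of which
   there is one copy for each tree t with n leaves *)
Definition Phi_span (n : nat) : set (Rec 1 (strands n)) :=
  [set xi | exists l : seq (C * tree),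
     all (fun p => leaves p.2 == n) l /\
     xi = \sum_(p <- l) p.1 *: (Phi 1 n [:: p.2] : Rec 1 (strands n))].

End Rec.

Section Representations.
Variable R : realType.
Local Notation C := R[i].

Record hilbertSpace := HilbertSpace {
  hspace :> completeNormedModType C;
  hdot : {dot hspace for Num.conj};
  hdot_norm : forall x : hspace, hdot x x = `|x| ^+ 2 }.

Definition unitary (H K : hilbertSpace) (U : {linear H -> K}) : Prop :=
  (forall x y, hdot K (U x) (U y) = hdot H x y) /\
  (forall y, exists x, U x = y).

Record unitaryRep := UnitaryRep {
  rep_space :> hilbertSpace;
  rep_op : thompsonF R -> {linear rep_space -> rep_space};
  rep_unitary : forall g, unitary (rep_op g);
  rep_mul : forall g h k : thompsonF R, (k : R -> R) =1 g \o h ->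
    rep_op k =1 rep_op g \o rep_op h }.

Definition unitarily_equivalent (P Q : unitaryRep) : Prop :=
  exists U : {linear P -> Q},
    unitary U /\ forall g x, U (rep_op P g x) = rep_op Q g (U x).

Lemma rep_sigma_mul (P : unitaryRep) (g h k : thompsonF R) :
  (k : R -> R) =1 g \o h ->
  rep_op P (sigmaF k) =1 rep_op P (sigmaF g) \o rep_op P (sigmaF h).
Proof.
move=> kE; apply: rep_mul => x.
by rewrite /= /flip_fun kE /= subKr.
Qed.

Definition rep_sigma (P : unitaryRep) : unitaryRep :=
  @UnitaryRep P (fun g => rep_op P (sigmaF g))
    (fun g => rep_unitary P (sigmaF g)) (@rep_sigma_mul P).

(* P is (a realization of) the Jones representation with parameters delta, a, b:
   its space is the completion of the inductive limit, j t being the canonical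
   map on the copy indexed by t, and the fraction t/s acts by the prescribed
   formula.  As the completion is only defined up to a unique isometry, these
   conditions determine P up to unitary equivalence.  They presuppose that
   rdot is positive semidefinite and that the maps xi |-> Phi f o xi are
   isometric, which is ensured by the admissibility of the loop parameter delta
   and by the normalization delta (|a|^2 + |b|^2) + a b^* + a^* b = 1. *)
Definition is_jones_rep (delta : R) (a b : C) (P : unitaryRep) : Prop :=
  let span n := Phi_span delta a b (n := n) in
  let Phi_ := Phi delta a b in
  exists j : forall t : tree, Rec R 1 (strands (leaves t)) -> P,
  [/\ forall t (c : C) xi eta, span _ xi -> span _ eta ->
        j t (c *: xi + eta) = c *: j t xi + j t eta,
      forall t xi eta, span _ xi -> span _ eta ->
        hdot P (j t xi) (j t eta) = rdot delta xi eta,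
      forall t f xi, size f = leaves t -> span _ xi ->
        j (graft f t)
          (rcomp delta (Phi_ (leaves t) (leaves (graft f t)) f) xi) = j t xi,
      dense [set x : P | exists t, exists2 xi, span _ xi & j t xi = x]
    & forall (g : thompsonF R) t s, is_fraction g t s ->
        forall v p q xi, size p = leaves s -> size q = leaves v ->
        graft p s = graft q v -> span _ xi ->
        rep_op P g (j v xi) =
        j (graft p t)
          (rcomp delta (Phi_ (leaves v) (leaves (graft p t)) q) xi)].

End Representations.

(* Main.v *)
Require Import Defs.
From HB Require Import structures.
From mathcomp Require Import all_boot all_order all_algebra.
From mathcomp Require Import complex.
From mathcomp Require Import all_classical all_reals all_analysis.
From mathcomp Require Import zify ring lra.

(** If a fraction with terms s, t is planted at a leaf of a tree v, its operator
    compresses to a scalar on H_v, namely the vacuum coefficient of (s, t): the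
    separating strands isolate the leaf.  As the spaces H_v exhaust a dense
    subspace, this scalar is a unitary invariant of the representation.  With
    equal positive parameters all vacuum coefficients are positive.  For the
    parameters of [Q], the fraction with source ((.(..)).) and target
    (.(.(..))) has coefficient 1, whereas its mirror image has coefficient 0.
    So in each of the three cases one element, planted at a suitable leaf,
    distinguishes the representations.

    Diagrams are coded by involutions of nat + nat (bottom and top points).  A
    tree expands to a sum of words of cups, and the inner product of two words
    is computed by capping one with the cups of the other. *)

Set Implicit Arguments.
Unset Strict Implicit.
Unset Printing Implicit Defensive.

Import Order.TTheory GRing.Theory Num.Theory.
Import numFieldNormedType.Exports.
Local Open Scope nat_scope.

(** * Planar diagrams *)

(** An intertwiner may send the vacuum vector outside every [H_v], so the group element is chosen
    only after an approximating vector, at a leaf of the tree [v] that carries this vector. On the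
    other side this does no harm: the vacuum vector comes from the trivial tree, hence lies in all
    the [H_v], and has the same coefficient wherever the fraction is planted. For the same reason
    [sigmaF] can be handled: the leaf at which an element acts and the leaf at which its mirror
    image acts may belong to unrelated trees.

    The scalar does not depend on [v] because, when two planted words of cups are glued, each cap
    meets a cup of the other word. Cancelling them one after the other, by closing a loop or
    straightening a strand, leaves the inner product of the diagrams below. That the cancellation
    never gets stuck is checked by evaluation on the trees in question.

    The functions that code diagrams do not mention the numbers of points, so inserting a cup
    involves no cast between the types [Rec m n]; the dimensions enter only through [planar]. *)

Definition code := (nat + nat)%type.

Definition code_of m n (p : bpoint m n) : code :=
  match p with inl i => inl (val i) | inr j => inr (val j) end.

Definition inside m n (x : code) : bool :=
  match x with inl i => i < m | inr j => j < n end.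

Definition code_pos m n (x : code) : nat :=
  match x with inl i => i | inr j => m + (n - j.+1) end.

Lemma code_of_inj m n : injective (@code_of m n).
Proof. by case=> i [] j //= [/val_inj->]. Qed.

Lemma code_ofP m n (p : bpoint m n) : inside m n (code_of p).
Proof. by case: p => i /=; exact: ltn_ord. Qed.

Lemma bposE m n (p : bpoint m n) : bpos p = code_pos m n (code_of p).
Proof. by case: p. Qed.

Lemma inside_code m n x : inside m n x -> {p : bpoint m n | code_of p = x}.
Proof.
by case: x => j /= jlt; [exists (inl (Ordinal jlt))|exists (inr (Ordinal jlt))].
Qed.

Record planar m n (f : code -> code) : Prop := Planar {
  planar_in : forall x, inside m n x -> inside m n (f x);
  planar_neq : forall x, inside m n x -> f x <> x;
  planarK : forall x, inside m n x -> f (f x) = x;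
  planar_nc : forall x y, inside m n x -> inside m n y ->
    ~ [/\ code_pos m n x < code_pos m n y,
          code_pos m n y < code_pos m n (f x)
        & code_pos m n (f x) < code_pos m n (f y)] }.

Definition codes m n (D : ncpairing m n) (f : code -> code) : bool :=
  [forall p, code_of (D p) == f (code_of p)].

Lemma codesP m n (D : ncpairing m n) f :
  reflect (forall p, code_of (D p) = f (code_of p)) (codes D f).
Proof. by apply: (iffP forallP) => h p; apply/eqP. Qed.

Lemma codes_inj m n (D E : ncpairing m n) f : codes D f -> codes E f -> D = E.
Proof.
move=> /codesP Df /codesP Ef; apply/val_inj/ffunP => p.
by apply: code_of_inj; rewrite Df Ef.
Qed.

Lemma codes_exists m n f : planar m n f -> {D : ncpairing m n | codes D f}.
Proof.
move=> fP.
have fin (p : bpoint m n) : inside m n (f (code_of p)).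
  exact: (planar_in fP (code_ofP p)).
pose F := [ffun p => sval (inside_code (fin p))].
have FE p : code_of (F p) = f (code_of p) by rewrite ffunE; case: inside_code.
have Fnc : is_ncpairing F.
  apply/andP; split; apply/forallP => p.
    apply/andP; split.
      apply/eqP => /(congr1 (@code_of m n)); rewrite FE.
      exact: (planar_neq fP (code_ofP p)).
    by apply/eqP/code_of_inj; rewrite !FE (planarK fP)// code_ofP.
  apply/forallP => q; apply/negP => /and3P[]; rewrite !bposE !FE => h1 h2 h3.
  by apply: (planar_nc fP (code_ofP p) (code_ofP q)).
by exists (NCPairing Fnc); apply/codesP => p /=; rewrite FE.
Qed.

Lemma pairing_neq m n (D : ncpairing m n) p : D p != p.
Proof. by have /andP[/forallP/(_ p)/andP[]] := pairingP D. Qed.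

Lemma pairingK m n (D : ncpairing m n) : involutive D.
Proof. by move=> p; have /andP[/forallP/(_ p)/andP[_ /eqP]] := pairingP D. Qed.

(* Insertion of a cup on the right of the first [i] top points. *)
Definition bump2 i j := if j < i then j else j.+2.
Definition unbump2 i j := if j < i then j else j.-2.

Definition up i (x : code) : code :=
  match x with inl j => inl j | inr j => inr (bump2 i j) end.

Definition insert i (f : code -> code) (x : code) : code :=
  match x with
  | inl j => up i (f (inl j))
  | inr j => if j == i then inr i.+1 else if j == i.+1 then inr i
             else up i (f (inr (unbump2 i j)))
  end.

Lemma insert_up i f x : insert i f (up i x) = up i (f x).
Proof.
case: x => j //=; rewrite /bump2 /unbump2.
have [ji|ij] := ltnP j i; first by rewrite ji !ifF//; lia.
by rewrite !ifF//; lia.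
Qed.

Lemma insert_cupl i f : insert i f (inr i) = inr i.+1.
Proof. by rewrite /= eqxx. Qed.

Lemma insert_cupr i f : insert i f (inr i.+1) = inr i.
Proof. by rewrite /= eqxx ifF//; lia. Qed.

Variant insert_spec m n i : code -> Type :=
  | InsertCupl : insert_spec m n i (inr i)
  | InsertCupr : insert_spec m n i (inr i.+1)
  | InsertUp x of inside m n x : insert_spec m n i (up i x).

Lemma insertP m n i x : i <= n -> inside m n.+2 x -> insert_spec m n i x.
Proof.
move=> ilen; case: x => j /= jlt.
  by rewrite -[inl j]/(up i (inl j)); apply: InsertUp.
have [->|ji] := eqVneq j i; first exact: InsertCupl.
have [->|ji1] := eqVneq j i.+1; first exact: InsertCupr.
have -> : inr j = up i (inr (unbump2 i j)).
  by rewrite /= /bump2 /unbump2; congr inr; do ?[case: ifP] => *; lia.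
by apply: InsertUp; rewrite /= /unbump2; case: ifP; lia.
Qed.

Lemma up_inside m n i x : inside m n x -> inside m n.+2 (up i x).
Proof. by case: x => j //= jn; rewrite /bump2; case: ifP; lia. Qed.

Lemma up_inj i : injective (up i).
Proof.
case=> j [] k //= [].
by rewrite /bump2; do ?[case: ifP] => *; congr inr; lia.
Qed.

Lemma code_pos_up m n i x y : i <= n -> inside m n x -> inside m n y ->
  (code_pos m n.+2 (up i x) < code_pos m n.+2 (up i y)) =
  (code_pos m n x < code_pos m n y).
Proof.
move=> ilen; case: x y => [j|j] [k|k] //=; rewrite /bump2;
  do ?[case: ifP] => *; lia.
Qed.

(** The ends of a cup are neighbours on the boundary and no other point separates them; this is why
    an inserted cup crosses nothing. *)
Lemma code_pos_cup m n i x : i <= n -> inside m n x ->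
  (code_pos m n.+2 (up i x) < code_pos m n.+2 (inr i)) =
  (code_pos m n.+2 (up i x) < code_pos m n.+2 (inr i.+1)).
Proof.
by move=> ilen; case: x => j //=; rewrite /bump2; do ?[case: ifP] => *; lia.
Qed.

Lemma planar_insert m n i f :
  planar m n f -> i <= n -> planar m n.+2 (insert i f).
Proof.
move=> fP ilen; split=> [x|x|x|x y] xin.
- case: (insertP ilen xin) => [||{xin}x xin].
  + by rewrite insert_cupl /=; lia.
  + by rewrite insert_cupr /=; lia.
  + by rewrite insert_up up_inside// (planar_in fP).
- case: (insertP ilen xin) => [||{xin}x xin].
  + by rewrite insert_cupl => -[]; lia.
  + by rewrite insert_cupr => -[]; lia.
  + by rewrite insert_up => /up_inj; exact: (planar_neq fP xin).
- case: (insertP ilen xin) => [||{xin}x xin].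
  + by rewrite insert_cupl insert_cupr.
  + by rewrite insert_cupr insert_cupl.
  + by rewrite !insert_up (planarK fP).
move=> yin.
(* Positions on the top run from right to left: the left end of the cup comes just after the right
   one. *)
have cupP : code_pos m n.+2 (inr i) = (code_pos m n.+2 (inr i.+1)).+1.
  by rewrite /=; lia.
case: (insertP ilen xin) => [||{xin}x xin].
- by rewrite insert_cupl cupP => -[]; lia.
- by rewrite insert_cupr cupP => -[]; lia.
case: (insertP ilen yin) => [||{yin}y yin].
- rewrite insert_cupl insert_up cupP => -[_]; lia.
- rewrite insert_cupr insert_up => -[_ h1].
  by rewrite code_pos_cup// ?(planar_in fP)//; lia.
rewrite !insert_up !code_pos_up// ?(planar_in fP)//.
exact: (planar_nc fP xin yin).
Qed.

Lemma eq_insert i f g : f =1 g -> insert i f =1 insert i g.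
Proof. by move=> fg [j|j] /=; rewrite fg. Qed.

Lemma up_lt i j : j < i -> up i (inr j) = inr j.
Proof. by move=> ji; rewrite /= /bump2 ji. Qed.

Lemma up_ge i j : i <= j -> up i (inr j) = inr j.+2.
Proof. by move=> ij; rewrite /= /bump2 ltnNge ij. Qed.

Lemma up_up i j x : i <= j -> up i (up j x) = up j.+2 (up i x).
Proof.
move=> ij; case: x => k //=; rewrite /bump2; congr inr.
by do ?[case: ifP] => *; lia.
Qed.

(** Source of the interchange of branchings: the left cup pushes everything on its right by two
    points, whence [j.+2]. *)
Lemma insert_insert i j f :
  i <= j -> insert i (insert j f) =1 insert j.+2 (insert i f).
Proof.
move=> ij [k|k]; first by rewrite /= up_up.
(* The statement has no dimensions; a number of top points is chosen large enough for [insertP]. *)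
have ki : inside 0 (maxn i k).+2 (inr k) by rewrite /=; lia.
case: (insertP (leq_maxl i k) ki) => [||x _].
- by rewrite insert_cupl -(@up_lt j.+2 i) ?insert_up ?insert_cupl ?up_lt//; lia.
- by rewrite insert_cupr -(@up_lt j.+2 i.+1) ?insert_up ?insert_cupr ?up_lt//; lia.
rewrite insert_up.
have [[l xE]|xN] : {l | x = inr l} + {forall l, x <> inr l}.
  by case: (x) => l; [right|left; exists l].
  have lj : inside 0 (maxn j l).+2 x by rewrite xE /=; lia.
  case: (insertP (leq_maxl j l) lj) => [||y _].
  + by rewrite insert_cupl !up_ge ?insert_cupl//; lia.
  + by rewrite insert_cupr !up_ge ?insert_cupr//; lia.
  + by rewrite insert_up !(up_up _ ij) insert_up insert_up.
case: x xN => [l _|l /(_ l)//].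
by rewrite /= up_up.
Qed.

Definition id_code (x : code) : code :=
  match x with inl j => inr j | inr j => inl j end.

Lemma planar_id n : planar n n id_code.
Proof.
split; [by case|by case|by case|].
by case=> i [] j /= ? ? []; lia.
Qed.

(** * Composition of diagrams when no loop appears *)

Lemma stacked_sym m k n (E : ncpairing k n) (D : ncpairing m k) :
  symmetric (stacked E D).
Proof.
suff sym u v : stacked E D u v -> stacked E D v u.
  by move=> u v; apply/idP/idP; exact: sym.
case/orP=> /existsP[p /andP[/eqP-> /eqP->]]; apply/orP; [left|right].
  by apply/existsP; exists (D p); rewrite pairingK !eqxx.
by apply/existsP; exists (E p); rewrite pairingK !eqxx.
Qed.

Lemma stacked_lower m k n (E : ncpairing k n) (D : ncpairing m k) p :
  stacked E D (lower_point n p) (lower_point n (D p)).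
Proof. by apply/orP; left; apply/existsP; exists p; rewrite !eqxx. Qed.

Lemma stacked_upper m k n (E : ncpairing k n) (D : ncpairing m k) p :
  stacked E D (upper_point m p) (upper_point m (E p)).
Proof. by apply/orP; right; apply/existsP; exists p; rewrite !eqxx. Qed.

(* The part of the composition [e o f] lying above a point of [f], when all the
   bottom points of [e] are connected to its top. *)
Definition carry (e : code -> code) (x : code) : code :=
  match x with inl i => inl i | inr j => e (inl j) end.

Definition compose (e f : code -> code) (x : code) : code :=
  match x with
  | inl i => carry e (f (inl i))
  | inr t => match e (inr t) with
             | inl j => carry e (f (inr j))
             | inr t' => inr t'
             end
  end.

Definition upward k (e : code -> code) : Prop :=
  forall j, j < k -> exists t, e (inl j) = inr t.

Section Composition.
Variables (m k n : nat) (E : ncpairing k n) (D : ncpairing m k).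
Variables (e f g : code -> code).
Hypotheses (eP : planar k n e) (gP : planar m n g).
Hypotheses (eU : upward k e) (Ee : codes E e) (Df : codes D f).
Hypothesis gE : forall x, inside m n x -> g x = compose e f x.

(** Selects an outer point on the component of each vertex: a glued point is followed through [e] up
    to the top. *)
Definition retract (u : spoint m k n) : code :=
  match u with
  | inl (inl i) => inl (val i)
  | inl (inr j) => e (inl (val j))
  | inr t => inr (val t)
  end.

Lemma retract_outer p : retract (outer_point k p) = code_of p.
Proof. by case: p. Qed.

Lemma retract_lower p : retract (lower_point n p) = carry e (code_of p).
Proof. by case: p. Qed.

Lemma retract_inside u : inside m n (retract u).
Proof.
case: u => [[i|j]|t] /=; rewrite ?ltn_ord//.
have [t et] := eU (ltn_ord j); rewrite et.
by have := planar_in eP (ltn_ord j : inside k n (inl (val j))); rewrite et.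
Qed.

Lemma compose_lower p :
  g (retract (lower_point n p)) = retract (lower_point n (D p)).
Proof.
rewrite gE ?retract_inside// !retract_lower (codesP _ _ Df).
case: p => [//|j] /=; have [t et] := eU (ltn_ord j).
by rewrite et /= -et (planarK eP)//=.
Qed.

Lemma compose_upper p :
  let r q := retract (upper_point m q) in r (E p) = r p \/ r (E p) = g (r p).
Proof.
move=> r; have := codesP _ _ Ee p; rewrite /r; case: p => [j|t] /=.
  have [t et] := eU (ltn_ord j); rewrite et.
  by case: (E _) => //= t' ->; left.
rewrite gE /= ?ltn_ord//; case eE : (E _) => [j|t'] /= <-; last by right.
left; have := codesP _ _ Ee (E (inr t)).
by rewrite pairingK eE.
Qed.

(** Along an edge the selected outer point either stays or jumps to the other end of its strand; as
    [g] is an involution, these two alternatives persist along a path. *)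
Lemma connect_retract u v : connect (stacked E D) u v ->
  retract v = retract u \/ retract v = g (retract u).
Proof.
case/connectP=> p + ->; elim: p u => [|w p IHp] u /=; first by left.
case/andP=> uw /IHp{IHp}.
have gg x : g (g (retract x)) = retract x by rewrite (planarK gP)// retract_inside.
have [->|->] : retract w = retract u \/ retract w = g (retract u).
- case/orP: uw => /existsP[q /andP[/eqP-> /eqP->]]; last exact: compose_upper.
  by right; rewrite compose_lower.
- by [].
- by rewrite gg => -[]; [right|left].
Qed.

Lemma connect_outer u p : retract u = code_of p ->
  connect (stacked E D) u (outer_point k p).
Proof.
case: u => [[i|j]|t] /= up.
- have -> : p = inl i by apply: (@code_of_inj m n); rewrite -up.
  exact: connect0.
- have := codesP _ _ Ee (inl j); rewrite /= up => Ep.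
  have -> : outer_point k p = upper_point m (E (inl j)).
    have [t et] := eU (ltn_ord j); move: Ep; rewrite -up et.
    case: (E _) => //= t' [t'E]; case: p up => [i|t2]; rewrite et //= => -[tE].
    by congr inr; apply/val_inj => /=; lia.
  by apply: connect1; exact: stacked_upper.
- have -> : p = inr t by apply: (@code_of_inj m n); rewrite -up.
  exact: connect0.
Qed.

Lemma connect_composition p q : code_of q = g (code_of p) ->
  connect (stacked E D) (outer_point k p) (outer_point k q).
Proof.
rewrite gE ?code_ofP//; case: p => [i|t] /= qE.
  apply: (connect_trans (connect1 (stacked_lower E D (inl i)))).
  by apply: connect_outer; rewrite retract_lower (codesP _ _ Df) qE.
apply: (connect_trans (connect1 (stacked_upper E D (inr t)))).
have := codesP _ _ Ee (inr t); case eE : (E _) => [j|t'] /= et; last first.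
  by apply: (@connect_outer (inr t')) => /=; rewrite qE -et.
apply: (connect_trans (connect1 (stacked_lower E D (inr j)))).
by apply: connect_outer; rewrite retract_lower (codesP _ _ Df) qE -et.
Qed.

(** A component meets the boundary only in a pair exchanged by [g]. Since [G] has no fixed point,
    connecting [p] with [G p] forces [G p] to be the partner of [p]. *)
Lemma stack_composition (G : ncpairing m n) : stack_pairing E D G = codes G g.
Proof.
apply/forallP/codesP => GP p.
  have [] := connect_retract (GP p); rewrite !retract_outer// => /code_of_inj Gp.
  by have := pairing_neq G p; rewrite Gp eqxx.
exact: connect_composition (GP p).
Qed.

Lemma loops_composition : loops E D = 0.
Proof.
apply: eq_card0 => u; rewrite !inE; apply/negP => /andP[_ /forallP uN].
have [p pu] := inside_code (retract_inside u).
by have := uN p; rewrite connect_outer.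
Qed.

End Composition.

(** * Diagrams as vectors *)

Section Diagrams.
Variable R : realType.
Local Notation C := R[i].
Local Open Scope ring_scope.

Definition diag m n (f : code -> code) : Rec R m n :=
  [ffun D => (codes D f)%:R].

Lemma eq_diag m n f g : f =1 g -> diag m n f = diag m n g.
Proof.
move=> fg; apply/ffunP => D; rewrite !ffunE; congr (_%:R); congr nat_of_bool.
by apply/codesP/codesP => Df p; rewrite Df fg.
Qed.

Lemma diag_codes m n (D : ncpairing m n) f : codes D f ->
  diag m n f = [ffun E => (E == D)%:R].
Proof.
move=> Df; apply/ffunP => E; rewrite !ffunE; congr (_%:R); congr nat_of_bool.
by apply/idP/eqP => [/codes_inj/(_ Df)|->].
Qed.

Lemma rcomp_diag (delta : R) m k n e f g :
  planar k n e -> planar m k f -> planar m n g -> upward k e ->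
  (forall x, inside m n x -> g x = compose e f x) ->
  rcomp delta (diag k n e) (diag m k f) = diag m n g.
Proof.
move=> eP fP gP eU gE; apply/ffunP => G.
have [E Ee] := codes_exists eP; have [D Df] := codes_exists fP.
rewrite (diag_codes Ee) (diag_codes Df) !ffunE (bigD1 E)//= [X in _ + X]big1 ?addr0.
  rewrite big_mkcond (bigD1 D)//= [X in _ + X]big1 ?addr0.
    rewrite (stack_composition eP gP eU Ee Df gE) (loops_composition eP eU Ee Df).
    by rewrite !ffunE !eqxx !mulr1 expr0; case: codes.
  by move=> D' /negPf D'D; rewrite !ffunE D'D mulr0; case: ifP.
move=> E' /negPf E'E; rewrite big1// => D' _.
by rewrite !ffunE E'E mulr0 mul0r.
Qed.

End Diagrams.

Lemma compose_id f : compose id_code f =1 f.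
Proof. by case=> j /=; case: (f _). Qed.

Lemma insert_compose i e f : insert i (compose e f) =1 compose (insert i e) f.
Proof.
have carryE x : up i (carry e x) = carry (insert i e) x by case: x.
case=> j /=; first exact: carryE.
case: ifP => // _; case: ifP => // _.
by case: (e _) => //= l; exact: carryE.
Qed.

Lemma upward_id n : upward n id_code.
Proof. by move=> j _; exists j. Qed.

Lemma upward_insert n i e : upward n e -> upward n (insert i e).
Proof. by move=> eU j /eU[t et]; exists (bump2 i t); rewrite /= et. Qed.

(* Over a forest whose branchings are at the roots [w], each branching [k]
   chooses between a cup to the right of its strand (weight [a]) and one to its
   left (weight [b]). *)
Section Labelings.
Variable R : realType.
Local Notation C := R[i].
Local Open Scope ring_scope.
Variables (a b : C).

Fixpoint labelings (L : lmodType C) (F : (code -> code) -> L) (w : seq nat)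
    (f : code -> code) : L :=
  if w is k :: w' then
    a *: labelings F w' (insert k.*2.+1 f) + b *: labelings F w' (insert k.*2 f)
  else F f.

(** Root [k] is the top point [k.*2]; the strict bound leaves room for the cup at [k.*2.+1] on its
    right. *)
Fixpoint fits (n : nat) (w : seq nat) : bool :=
  if w is k :: w' then (k.*2 < n)%N && fits n.+2 w' else true.

End Labelings.

Section Bilinearity.
Variable R : realType.
Local Notation C := R[i].
Local Open Scope ring_scope.
Variables (delta : R).

Lemma rcompDl m k n (x x' : Rec R k n) (y : Rec R m k) :
  rcomp delta (x + x') y = rcomp delta x y + rcomp delta x' y.
Proof.
apply/ffunP => G; rewrite !ffunE -big_split/=; apply: eq_bigr => E _.
rewrite -big_split/=; apply: eq_bigr => D _.
by rewrite !ffunE mulrDr mulrDl.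
Qed.

Lemma rcompDr m k n (x : Rec R k n) (y y' : Rec R m k) :
  rcomp delta x (y + y') = rcomp delta x y + rcomp delta x y'.
Proof.
apply/ffunP => G; rewrite !ffunE -big_split/=; apply: eq_bigr => E _.
rewrite -big_split/=; apply: eq_bigr => D _.
by rewrite !ffunE mulrDr.
Qed.

Lemma rcompZl m k n (c : C) (x : Rec R k n) (y : Rec R m k) :
  rcomp delta (c *: x) y = c *: rcomp delta x y.
Proof.
apply/ffunP => G; rewrite !ffunE scaler_sumr; apply: eq_bigr => E _.
rewrite scaler_sumr; apply: eq_bigr => D _.
by rewrite !ffunE /GRing.scale /= mulrCA !mulrA.
Qed.

Lemma rcompZr m k n (c : C) (x : Rec R k n) (y : Rec R m k) :
  rcomp delta x (c *: y) = c *: rcomp delta x y.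
Proof.
apply/ffunP => G; rewrite !ffunE scaler_sumr; apply: eq_bigr => E _.
rewrite scaler_sumr; apply: eq_bigr => D _.
by rewrite !ffunE /GRing.scale /= mulrCA.
Qed.

Lemma rtensorDl m n m' n' (x x' : Rec R m n) (y : Rec R m' n') :
  rtensor (x + x') y = rtensor x y + rtensor x' y.
Proof.
apply/ffunP => G; rewrite !ffunE -big_split/=; apply: eq_bigr => D _.
rewrite -big_split/=; apply: eq_bigr => E _.
by rewrite !ffunE mulrDl.
Qed.

Lemma rtensorDr m n m' n' (x : Rec R m n) (y y' : Rec R m' n') :
  rtensor x (y + y') = rtensor x y + rtensor x y'.
Proof.
apply/ffunP => G; rewrite !ffunE -big_split/=; apply: eq_bigr => D _.
rewrite -big_split/=; apply: eq_bigr => E _.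
by rewrite !ffunE mulrDr.
Qed.

Lemma rtensorZl m n m' n' (c : C) (x : Rec R m n) (y : Rec R m' n') :
  rtensor (c *: x) y = c *: rtensor x y.
Proof.
apply/ffunP => G; rewrite !ffunE scaler_sumr; apply: eq_bigr => D _.
rewrite scaler_sumr; apply: eq_bigr => E _.
by rewrite !ffunE /GRing.scale /= mulrA.
Qed.

Lemma rtensorZr m n m' n' (c : C) (x : Rec R m n) (y : Rec R m' n') :
  rtensor x (c *: y) = c *: rtensor x y.
Proof.
apply/ffunP => G; rewrite !ffunE scaler_sumr; apply: eq_bigr => D _.
rewrite scaler_sumr; apply: eq_bigr => E _.
by rewrite !ffunE /GRing.scale /= mulrCA.
Qed.

Lemma rconformE m n (x : Rec R m n) : rconform m n x = x.
Proof.
rewrite /rconform; case: eqP => // em; case: eqP => // en.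
by rewrite (eq_irrelevance em erefl) (eq_irrelevance en erefl).
Qed.

Lemma rconformD m n m' n' (x y : Rec R m n) :
  rconform m' n' (x + y) = rconform m' n' x + rconform m' n' y.
Proof.
rewrite /rconform; case: eqP => [em|_]; last by rewrite addr0.
case: eqP => [en|_]; last by rewrite addr0.
by case: _ / em; case: _ / en.
Qed.

Lemma rconformZ m n m' n' (c : C) (x : Rec R m n) :
  rconform m' n' (c *: x) = c *: rconform m' n' x.
Proof.
rewrite /rconform; case: eqP => [em|_]; last by rewrite scaler0.
case: eqP => [en|_]; last by rewrite scaler0.
by case: _ / em; case: _ / en.
Qed.

Lemma rconform_diag m n m' n' f : m = m' -> n = n' ->
  rconform m' n' (diag R m n f) = diag R m' n' f.
Proof. by move=> <- <-; rewrite rconformE. Qed.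

End Bilinearity.

Definition shift m n (x : code) : code :=
  match x with inl i => inl (m + i) | inr j => inr (n + j) end.

(** * Images of forests as sums of cup insertions *)

Section Generators.
Variable R : realType.
Local Notation C := R[i].
Local Open Scope ring_scope.

Lemma rid_diag n : rid R n = diag R n n id_code.
Proof.
apply/ffunP => D; rewrite !ffunE; congr (_%:R); congr nat_of_bool.
apply/forallP/codesP => [DE [j|j]|DE j] /=.
- by rewrite (eqP (DE j)).
- by rewrite -(eqP (DE j)) pairingK.
- apply/eqP; apply: (@code_of_inj n n); exact: DE.
Qed.

Lemma code_left m n m' n' (p : bpoint m n) :
  code_of (left_point m' n' p) = code_of p.
Proof. by case: p. Qed.

Lemma code_right m n m' n' (p : bpoint m' n') :
  code_of (right_point m n p) = shift m n (code_of p).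
Proof. by case: p. Qed.

Lemma left_or_right m n m' n' (p : bpoint (m + m') (n + n')) :
  (exists q, p = left_point m' n' q) \/ (exists q, p = right_point m n q).
Proof.
by case: p => i; rewrite -(fintype.splitK i); case: (fintype.split i) => j /=;
  [left; exists (inl j)|right; exists (inl j)|left; exists (inr j)
  |right; exists (inr j)].
Qed.

Lemma rtensor_diag m n m' n' f g h :
  planar m n f -> planar m' n' g ->
  (forall x, inside m n x -> h x = f x) ->
  (forall x, inside m' n' x -> h (shift m n x) = shift m n (g x)) ->
  rtensor (diag R m n f) (diag R m' n' g) = diag R (m + m') (n + n') h.
Proof.
move=> fP gP hf hg; apply/ffunP => G.
have [D Df] := codes_exists fP; have [E Eg] := codes_exists gP.
rewrite (diag_codes _ Df) (diag_codes _ Eg) !ffunE.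
rewrite (bigD1 D)//= [X in _ + X]big1 ?addr0; last first.
  by move=> D' /negPf D'D; rewrite big1// => E' _; rewrite !ffunE D'D mul0r.
rewrite big_mkcond (bigD1 E)//= [X in _ + X]big1 ?addr0; last first.
  by move=> E' /negPf E'E; rewrite !ffunE E'E mulr0; case: ifP.
rewrite !ffunE !eqxx mulr1.
suff -> : juxtaposition D E G = codes G h by case: codes.
apply/andP/codesP => [[/forallP Gl /forallP Gr] p|GE].
  have [[q ->]|[q ->]] := left_or_right p.
    by rewrite (eqP (Gl q)) !code_left (codesP _ _ Df) hf// code_ofP.
  by rewrite (eqP (Gr q)) !code_right (codesP _ _ Eg) hg// code_ofP.
split; apply/forallP => q; apply/eqP; apply: code_of_inj; rewrite GE.
  by rewrite !code_left (codesP _ _ Df) hf// code_ofP.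
by rewrite !code_right (codesP _ _ Eg) hg// code_ofP.
Qed.

Lemma rcup_diag : rcup R = diag R 0 2 (insert 0 id_code).
Proof.
apply/ffunP => D; rewrite !ffunE; suff -> : codes D (insert 0 id_code) by [].
apply/codesP => -[[]//|j]; have := pairing_neq D (inr j).
case: (D (inr j)) => [[]//|k]; case: j k => -[|[|//]] ? [[|[|//]] ?] //=;
  by rewrite (_ : inr _ == inr _ = true)//; apply/eqP; congr inr; apply/val_inj.
Qed.

Variables (a b : C).

Lemma rho_diag : rho a b =
  a *: diag R 1 3 (insert 1 id_code) + b *: diag R 1 3 (insert 0 id_code).
Proof.
have cupr : rtensor (rid R 1) (rcup R) = diag R (1 + 0) (1 + 2) (insert 1 id_code).
  rewrite rid_diag rcup_diag; apply: rtensor_diag.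
  - exact: planar_id.
  - exact: (planar_insert (planar_id 0)).
  - by case=> -[].
  - by case=> // -[|[|]].
have cupl : rtensor (rcup R) (rid R 1) = diag R (0 + 1) (2 + 1) (insert 0 id_code).
  rewrite rid_diag rcup_diag; apply: rtensor_diag.
  - exact: (planar_insert (planar_id 0)).
  - exact: planar_id.
  - by case=> // -[|[|]].
  - by case=> -[].
by rewrite /rho cupr cupl.
Qed.

(** The cases [i = 1] and [i = 0] are the two terms of [rho], with the cup to the right and to the
    left of its strand. *)
Lemma strand_diag p r i : (i <= 1)%N ->
  rtensor (rtensor (rid R p) (diag R 1 3 (insert i id_code))) (rid R r) =
  diag R (p + 1 + r) (p + 3 + r) (insert (p + i) id_code).
Proof.
move=> i1; have i0P : planar 1 3 (insert i id_code).
  exact: (planar_insert (planar_id 1)).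
have ipP : planar (p + 1) (p + 3) (insert (p + i) id_code).
  have -> : (p + 3 = (p + 1).+2)%N by lia.
  by apply: (planar_insert (planar_id _)); lia.
rewrite !rid_diag (@rtensor_diag _ _ _ _ _ _ (insert (p + i) id_code))//.
- apply: rtensor_diag => //; first exact: planar_id.
  case=> j /= jr; first by congr inr; rewrite /bump2 ifF; lia.
  by rewrite /unbump2 !ifF /=; [congr inl|..]; lia.
- exact: planar_id.
- case=> j /= jp; first by congr inr; rewrite /bump2 ifT; lia.
  have [-> ->] : (j == p + i)%N = false /\ (j == (p + i).+1)%N = false by lia.
  by rewrite /= /unbump2 ifT//; lia.
case=> j /= j1; first by congr inr; rewrite /bump2; do ?[case: ifP] => *; lia.
have -> : (p + j == p + i)%N = (j == i) by lia.
have -> : (p + j == (p + i).+1)%N = (j == i.+1) by lia.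
case: ifP => ji /=; first by congr inr; lia.
case: ifP => ji1 /=; first by congr inr; lia.
by congr inl; rewrite /unbump2; do ?[case: ifP] => *; lia.
Qed.

Lemma Phi_branching_diag n k : (k <= n)%N ->
  Phi_branching a b n.+1 k =
  a *: diag R (strands n.+1) (strands n.+2) (insert k.*2.+1 id_code) +
  b *: diag R (strands n.+1) (strands n.+2) (insert k.*2 id_code).
Proof.
move=> kn; rewrite /Phi_branching rho_diag.
rewrite rtensorDr !rtensorZr rtensorDl !rtensorZl rconformD !rconformZ.
rewrite !strand_diag// addn0 addn1.
by rewrite !rconform_diag// /strands; lia.
Qed.

Variable delta : R.

(** Insertions act at the top and therefore commute with stacking on [f]; a composition of diagrams
    is evaluated in the base case alone. *)
Lemma rcomp_labelings m k n N w e f g :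
  planar k n e -> upward k e -> planar m k f -> planar m n g ->
  g =1 compose e f -> fits n w -> N = (n + (size w).*2)%N ->
  rcomp delta (labelings a b (diag R k N) w e) (diag R m k f) =
  labelings a b (diag R m N) w g.
Proof.
move=> + + fP + + + ->; elim: w n e g => [|i w IHw] n e g eP eU gP gE /=.
  by rewrite addn0 => _; apply: rcomp_diag.
case/andP=> ilt wf; have -> : (n + (size w).+1.*2 = n.+2 + (size w).*2)%N by lia.
rewrite rcompDl !rcompZl.
have gEi j : insert j g =1 compose (insert j e) f.
  by move=> x; rewrite -insert_compose; exact: eq_insert.
congr (_ *: _ + _ *: _); apply: IHw => //;
  by [apply: planar_insert => //; lia|exact: upward_insert].
Qed.

Lemma Phi_growth_labelings n m w :
  fits (strands n.+1) w -> m = (n.+1 + size w)%N ->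
  Phi_growth delta a b n.+1 m w =
  labelings a b (diag R (strands n.+1) (strands m)) w id_code.
Proof.
elim: w n => [|k w IHw] n /=.
  by rewrite addn0 => _ ->; rewrite rconformE rid_diag.
case/andP=> kn wf mE; rewrite (IHw n.+1)//; last by lia.
rewrite Phi_branching_diag; last by move: kn; rewrite /strands; lia.
have iP i : (i <= strands n.+1)%N ->
    planar (strands n.+1) (strands n.+2) (insert i id_code).
  exact: (planar_insert (planar_id _)).
rewrite rcompDr !rcompZr; congr (_ *: _ + _ *: _);
  (apply: rcomp_labelings; [exact: planar_id|exact: upward_id|apply: iP; lia
    |apply: iP; lia|by move=> x; rewrite compose_id|by []
    |by rewrite mE /strands; lia]).
Qed.

End Generators.

(** * Gluing and the inner product *)

Lemma fixfree_even (T : finType) (f : T -> T) (A : {set T}) :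
  (forall x, x \in A -> [/\ f x \in A, f x != x & f (f x) = x]) -> ~~ odd #|A|.
Proof.
elim: {A}_.+1 {-2}A (ltnSn #|A|) => // n IHn A An fA.
have [->|[x xA]] := set_0Vmem A; first by rewrite cards0.
have [fxA fxx ffx] := fA x xA.
have fxA' : f x \in A :\ x by rewrite !inE fxx.
rewrite (cardsD1 x A) xA (cardsD1 (f x) (A :\ x)) fxA' !add1n /= negbK.
apply: IHn => [|y].
  by move: An; rewrite (cardsD1 x A) xA (cardsD1 (f x) (A :\ x)) fxA'; lia.
rewrite !inE => /and3P[yfx yx yA]; have [fyA fyy ffy] := fA y yA.
split=> //; rewrite fyA andbT; apply/andP; split.
  by apply: contra yx => /eqP/(congr1 f); rewrite ffy ffx => ->.
by apply: contra yfx => /eqP/(congr1 f); rewrite ffy => ->.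
Qed.

(** The common form of the component counts below: [h] embeds the smaller graph into the larger one,
    and [r] retracts the larger one onto it along paths. *)
Lemma n_comp_retract (T T' : finType) (e : rel T) (e' : rel T') (a : {pred T})
    (h : T' -> T) (r : T -> T') :
  symmetric e -> symmetric e' -> closed_mem e (mem a) ->
  (forall x, h x \in a) -> cancel h r ->
  (forall x y, e' x y -> connect e (h x) (h y)) ->
  (forall x y, x \in a -> e x y -> connect e' (r x) (r y)) ->
  (forall x, x \in a -> connect e x (h (r x))) ->
  n_comp e a = n_comp e' predT.
Proof.
move=> se se' ca ha hK he re hr.
rewrite (adjunction_n_comp h (e' := e'))//.
- by apply: eq_n_comp_r => x; rewrite !inE; exact: ha.
- exact: sym_connect_sym.
- exact: sym_connect_sym.
apply: (intro_adjunction (sym_connect_sym se') ca (fun x _ => r x)) => //.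
  by move=> x xa; split=> [|y _]; [exact: hr|exact: re].
by move=> x xa; rewrite hK; split=> [|y]; [exact: connect0|exact: he].
Qed.

Lemma planar_mirror m n f :
  planar m n f -> planar n m (id_code \o f \o id_code).
Proof.
have idK : involutive id_code by case.
have idin a b x : inside a b (id_code x) = inside b a x by case: x.
move=> fP; split=> [x|x|x|x y].
- by rewrite -[inside n m x]idin => /(planar_in fP) /=; rewrite idin.
- rewrite -[inside n m x]idin => /(planar_neq fP) /= fx xE; apply: fx.
  by rewrite -[in RHS]xE idK.
- by rewrite -[inside n m x]idin => xin /=; rewrite idK (planarK fP)// idK.
rewrite -[inside n m x]idin -[inside n m y]idin /= => xin yin.
(* The reflection reverses the order of the boundary points, so a crossing of [x] and [y] becomes
   one of [f y] and [f x]. *)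
have posE z : inside m n z ->
    code_pos n m (id_code z) + code_pos m n z = (m + n).-1.
  by case: z => j /=; lia.
rewrite -(idK x) -(idK y) !(idK (id_code _)).
move: xin yin; move: (id_code x) (id_code y) => {}x {}y xin yin.
have fx := planar_in fP xin; have fy := planar_in fP yin.
move: (posE _ xin) (posE _ yin) (posE _ fx) (posE _ fy) => h1 h2 h3 h4 [h5 h6 h7].
apply: (planar_nc fP fy fx); rewrite !(planarK fP)//; split; lia.
Qed.

Definition decode n (x : code) : bpoint 1 n :=
  match x with
  | inl _ => inl ord0
  | inr j => if insub j is Some l then inr l else inl ord0
  end.

Lemma decodeK n x : inside 1 n x -> code_of (decode n x) = x.
Proof. by case: x => [[]|j] //= jn; rewrite insubT. Qed.

Lemma code_ofK n : cancel (@code_of 1 n) (decode n).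
Proof. by move=> p; apply: code_of_inj; rewrite decodeK// code_ofP. Qed.

(** The curves obtained by gluing [f] to the mirror image of [g] along all points. The two bottom
    points are identified as well, so the strand through them is closed up and counts as one more
    component. *)
Definition glue n (f g : code -> code) : rel (bpoint 1 n) := [rel p q |
  (code_of q == f (code_of p)) || (code_of q == g (code_of p))].

Arguments glue : clear implicits.

Lemma glueE n f g p q : glue n f g p q =
  (code_of q == f (code_of p)) || (code_of q == g (code_of p)).
Proof. by []. Qed.

Definition components n f g : nat := n_comp (glue n f g) predT.

Lemma glue_sym n f g : planar 1 n f -> planar 1 n g -> symmetric (glue n f g).
Proof.
move=> fP gP; suff sym p q : glue n f g p q -> glue n f g q p.
  by move=> p q; apply/idP/idP; exact: sym.
case/orP=> /eqP qp; apply/orP; [left|right].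
  by rewrite qp (planarK fP) ?code_ofP.
by rewrite qp (planarK gP) ?code_ofP.
Qed.

Lemma up_cup i x : up i x != inr i /\ up i x != inr i.+1.
Proof.
case: x => j //=; split; apply/eqP => -[]; rewrite /bump2; case: ifP; lia.
Qed.

Lemma components_insert n i f g : planar 1 n f -> planar 1 n g -> i <= n ->
  components n.+2 (insert i f) (insert i g) = (components n f g).+1.
Proof.
move=> fP gP ilen; set e := glue n.+2 (insert i f) (insert i g).
have se : symmetric e by apply: glue_sym; exact: planar_insert.
pose a := [pred p : bpoint 1 n.+2 | (code_of p != inr i) && (code_of p != inr i.+1)].
have aP (p : bpoint 1 n.+2) :
    p \in a -> exists2 x, inside 1 n x & code_of p = up i x.
  rewrite inE /=; case: (insertP ilen (code_ofP p)); rewrite ?eqxx ?andbF//.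
  by move=> x xin _; exists x.
have ca : closed_mem e (mem a).
  apply: (intro_closed (sym_connect_sym se)) => p q /orP[] /eqP qp /aP[x xin pE].
    by rewrite inE qp pE insert_up; have [-> ->] := up_cup i (f x).
  by rewrite inE qp pE insert_up; have [-> ->] := up_cup i (g x).
have [c cE] : {c : bpoint 1 n.+2 | code_of c = inr i}.
  by apply: inside_code => /=; lia.
have [c' c'E] : {c : bpoint 1 n.+2 | code_of c = inr i.+1}.
  by apply: inside_code => /=; lia.
(* The ends of the common cup form a component by themselves; the other points carry the old
   graph. *)
rewrite /components (n_compC (connect e c)) (n_comp_connect (sym_connect_sym se)).
rewrite add1n; congr S; have cc' : e c c' by rewrite /e glueE cE c'E insert_cupl eqxx.
have ->: n_comp e [predC connect e c] = n_comp e a.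
  apply: eq_n_comp_r => p; rewrite [LHS]inE /=; apply/idP/idP => [cp|pa].
    rewrite inE; apply/andP; split; apply: contra cp => /eqP pE.
      have -> : p = c by apply: (@code_of_inj 1); rewrite pE cE.
      exact: connect0.
    have -> : p = c' by apply: (@code_of_inj 1); rewrite pE c'E.
    exact: connect1.
  by apply/negP => /(closed_connect ca); rewrite pa inE cE eqxx.
have upin x : inside 1 n x -> inside 1 n.+2 (up i x) by exact: up_inside.
have rP x : inside 1 n x ->
    code_of (decode n.+2 (up i x)) = up i x by move=> xin; rewrite decodeK ?upin.
have upK : cancel (up i) (fun x => match x with inl j => inl j
    | inr j => inr (unbump2 i j) end).
  case=> j //=; rewrite /bump2 /unbump2; congr inr.
  by do ?[case: ifP] => *; lia.
pose down x : code := match x with inl j => inl j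
    | inr j => inr (unbump2 i j) end.
apply: (@n_comp_retract _ _ _ _ a (fun p => decode n.+2 (up i (code_of p)))
  (fun p => decode n (down (code_of p)))) => //.
- exact: glue_sym.
- by move=> p; rewrite inE rP ?code_ofP//; have [-> ->] := up_cup i (code_of p).
- by move=> p; rewrite rP ?code_ofP// [down _]upK code_ofK.
- by move=> p q /orP[] /eqP qp; apply: connect1; rewrite /e glueE !rP ?code_ofP//;
    rewrite qp !insert_up eqxx ?orbT.
- move=> p q /aP[x xin pE] /orP[] /eqP qE; apply: connect1;
  rewrite glueE qE pE insert_up [down _]upK [down _]upK.
    by rewrite !decodeK ?(planar_in fP)// eqxx.
  by rewrite !decodeK ?(planar_in gP)// eqxx orbT.
- by move=> p /aP[x xin pE]; rewrite pE [down _]upK decodeK// -pE code_ofK.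
Qed.

(* [g] is obtained from [g'] by joining the top points [i] and [i.+1], which
   closes a loop if [l] is true. *)
Definition is_cap n i (l : bool) (g' g : code -> code) : Prop :=
  (g' (inr i) == inr i.+1) = l /\ forall z, inside 1 n z ->
    [\/ g' (up i z) = up i (g z),
        g' (up i z) = inr i /\ g' (inr i.+1) = up i (g z)
      | g' (up i z) = inr i.+1 /\ g' (inr i) = up i (g z)].

(** In the glued graph the cup of [insert i f] joins the points [i] and [i.+1] of [g'], which is
    precisely the effect of the cap. *)
Lemma components_cap n i l f g' g :
  planar 1 n f -> planar 1 n.+2 g' -> planar 1 n g -> i <= n -> is_cap n i l g' g ->
  components n.+2 (insert i f) g' = l + components n f g.
Proof.
move=> fP g'P gP ilen [<- gcap].
have iin : inside 1 n.+2 (inr i) by rewrite /=; lia.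
have i1in : inside 1 n.+2 (inr i.+1) by rewrite /=; lia.
have upin z : inside 1 n z -> inside 1 n.+2 (up i z) by exact: up_inside.
(* If the cap closes a loop, [g'] contains the same cup and agrees with [insert i g]. *)
have [g'i|/eqP g'iN] := eqVneq (g' (inr i)) (inr i.+1).
  rewrite add1n -(components_insert fP gP ilen).
  suff g'E (p : bpoint 1 n.+2) : g' (code_of p) = insert i g (code_of p).
    by apply: eq_n_comp; apply: eq_connect => p q; rewrite !glueE g'E.
  have g'i1 : g' (inr i.+1) = inr i by rewrite -g'i (planarK g'P).
  case: (insertP ilen (code_ofP p)) => [||z zin].
  - by rewrite insert_cupl.
  - by rewrite insert_cupr.
  rewrite insert_up; case: (gcap z zin) => [//|[h _]|[h _]].
    have := planarK g'P (upin z zin); rewrite h g'i => /esym/eqP.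
    by rewrite (negPf (up_cup i z).2).
  have := planarK g'P (upin z zin); rewrite h g'i1 => /esym/eqP.
  by rewrite (negPf (up_cup i z).1).
have g'i1N : g' (inr i.+1) <> inr i.
  by move=> h; apply: g'iN; rewrite -h (planarK g'P).
have [zl zlin zlE] : exists2 z, inside 1 n z & g' (inr i) = up i z.
  have := planar_in g'P iin; have := planar_neq g'P iin.
  move E : (g' (inr i)) => x xi xin; case: (insertP ilen xin) E xi => [_ []//|//|z].
  by exists z.
have [zr zrin zrE] : exists2 z, inside 1 n z & g' (inr i.+1) = up i z.
  have := planar_in g'P i1in; have := planar_neq g'P i1in.
  move E : (g' (inr i.+1)) => x xi xin.
  by case: (insertP ilen xin) E xi => [//|_ []//|z]; exists z.
(* The two capped points retract to [zl] and [zr], the points which they reach in [g'] and which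
   become partners in [g]. *)
pose down (x : code) : code := match x with inl j => inl j
  | inr j => if j == i then zl else if j == i.+1 then zr else inr (unbump2 i j) end.
have upK : cancel (up i) down.
  case=> j //=; rewrite /bump2 /unbump2; case: (ltnP j i) => ji.
    have [-> ->] : (j == i) = false /\ (j == i.+1) = false by lia.
    by rewrite ji.
  have [-> ->] : (j.+2 == i) = false /\ (j.+2 == i.+1) = false by lia.
  by rewrite ifF//; lia.
have downl : down (inr i) = zl by rewrite /= eqxx.
have downr : down (inr i.+1) = zr by rewrite /= eqxx ifF//; lia.
set e := glue n.+2 (insert i f) g'; rewrite add0n.
have se : symmetric e by apply: glue_sym => //; exact: planar_insert.
have dec x : inside 1 n.+2 x -> code_of (decode n.+2 x) = x by exact: decodeK.
have upP (p : bpoint 1 n) : inside 1 n.+2 (up i (code_of p)).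
  exact/upin/code_ofP.
have g'l : g' (up i zl) = inr i by rewrite -zlE (planarK g'P).
have g'r : g' (up i zr) = inr i.+1 by rewrite -zrE (planarK g'P).
apply: (@n_comp_retract _ _ _ _ predT (fun p => decode n.+2 (up i (code_of p)))
  (fun p => decode n (down (code_of p)))) => //.
- exact: glue_sym.
- by move=> p; rewrite dec// upK code_ofK.
- move=> p q /orP[] /eqP qp; rewrite -/e.
    by apply: connect1; rewrite /e glueE !dec// qp insert_up eqxx.
  have step x y : inside 1 n.+2 x -> inside 1 n.+2 y ->
      (y = insert i f x) \/ (y = g' x) ->
      connect e (decode n.+2 x) (decode n.+2 y).
    move=> xin yin xy; apply: connect1; rewrite /e glueE !dec//.
    by case: xy => ->; rewrite eqxx ?orbT.
  have := gcap _ (code_ofP p); rewrite -qp => -[h|[h1 h2]|[h1 h2]].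
  + by apply: step => //; right.
  + apply: (connect_trans (step _ (inr i) _ _ _)) => //; first by right.
    apply: (connect_trans (step _ (inr i.+1) _ _ _)) => //.
      by left; rewrite insert_cupl.
    by apply: step => //; right.
  + apply: (connect_trans (step _ (inr i.+1) _ _ _)) => //; first by right.
    apply: (connect_trans (step _ (inr i) _ _ _)) => //.
      by left; rewrite insert_cupr.
    by apply: step => //; right.
- have gl : g zl = zr.
    have := gcap zl zlin; rewrite g'l => -[/esym/eqP|[_]|[[]]]; last by lia.
      by rewrite (negPf (up_cup _ _).1).
    by rewrite zrE => /up_inj.
  have step x y : inside 1 n x -> inside 1 n y -> (y = f x) \/ (y = g x) ->
      connect (glue n f g) (decode n x) (decode n y).
    move=> xin yin xy; apply: connect1; rewrite glueE !decodeK//.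
    by case: xy => ->; rewrite eqxx ?orbT.
  move=> p q _ /orP[] /eqP ->; case: (insertP ilen (code_ofP p)) => [||z zin].
  + by rewrite insert_cupl downl downr; apply: step => //; right.
  + rewrite insert_cupr downl downr; apply: step => //; right.
    by rewrite -gl (planarK gP).
  + by rewrite insert_up !upK; apply: step; [|exact: (planar_in fP zin)|left].
  + by rewrite zlE downl upK connect0.
  + by rewrite zrE downr upK connect0.
  rewrite upK; case: (gcap z zin) => [->|[h1 h2]|[h1 h2]].
  + by rewrite upK; apply: step; [|exact: (planar_in gP zin)|right].
  + by rewrite h1 downl -(upK z) -(planarK g'P (upin z zin)) h1 zlE upK connect0.
  + by rewrite h1 downr -(upK z) -(planarK g'P (upin z zin)) h1 zrE upK connect0.
- move=> p _; rewrite -/e -{1}[p]code_ofK.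
  case: (insertP ilen (code_ofP p)) => [||z zin].
  + rewrite downl decodeK//; apply: connect1.
    by rewrite /e glueE !dec ?upin// zlE eqxx orbT.
  + rewrite downr decodeK//; apply: connect1.
    by rewrite /e glueE !dec ?upin// zrE eqxx orbT.
  + by rewrite upK decodeK.
Qed.

Lemma up_neq i x : x <> inr i -> up i x = up i.+1 x.
Proof.
case: x => j //= ji; have {}ji : j <> i by move=> ji'; rewrite ji' in ji.
by congr inr; rewrite /bump2; do ?[case: ifP] => *; lia.
Qed.

Lemma is_cap_insert n i g : is_cap n i true (insert i g) g.
Proof.
split=> [|z _]; first by rewrite insert_cupl eqxx.
by rewrite insert_up; constructor.
Qed.

(** The snake identity: cap and cup share one point and straighten to a strand. Relabelling by
    [up i] or by [up i.+1] differs at [inr i] alone, hence the case distinctions. *)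
Lemma is_cap_insertS n i g :
  planar 1 n g -> i < n -> is_cap n i false (insert i.+1 g) g.
Proof.
move=> gP iltn; have lti : i < i.+1 by [].
split=> [|z zin].
  by rewrite -(up_lt lti) insert_up (negPf (up_cup _ _).1).
have [->|/eqP zi] := eqVneq z (inr i).
  have gi : g (inr i) <> inr i by exact: (planar_neq gP (iltn : inside 1 n (inr i))).
  have g'i : insert i.+1 g (inr i) = up i (g (inr i)).
    by rewrite -{1}(up_lt lti) insert_up (up_neq gi).
  by rewrite (@up_ge i i)// insert_cupr g'i; constructor 3.
rewrite up_neq// insert_up insert_cupl.
have [->|/eqP gzi] := eqVneq (g z) (inr i); last by rewrite -up_neq//; constructor.
by rewrite up_lt// up_ge//; constructor 2.
Qed.

Lemma is_cap_insert_pred n i g :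
  planar 1 n g -> i < n -> is_cap n i.+1 false (insert i g) g.
Proof.
move=> gP iltn; have lti : i < i.+1 by [].
split=> [|z zin]; first by rewrite insert_cupr; apply/eqP => -[]; lia.
have [->|/eqP zi] := eqVneq z (inr i).
  have gi : g (inr i) <> inr i by exact: (planar_neq gP (iltn : inside 1 n (inr i))).
  have g'i : insert i g (inr i.+2) = up i.+1 (g (inr i)).
    by rewrite -(@up_ge i i)// insert_up (up_neq gi).
  by rewrite up_lt// insert_cupl g'i; constructor 2.
rewrite -up_neq// insert_up insert_cupr.
have [->|/eqP gzi] := eqVneq (g z) (inr i); last by rewrite up_neq//; constructor.
by rewrite (@up_ge i i)// up_lt//; constructor 3.
Qed.

Lemma is_cap_insert_below n i j l g' g : j <= i -> i <= n ->
  is_cap n i l g' g -> is_cap n.+2 i.+2 l (insert j g') (insert j g).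
Proof.
move=> ji ilen [<- gcap]; have jn : j <= n by lia.
have iE : inr i.+2 = up j (inr i) by rewrite up_ge.
have i1E : inr i.+3 = up j (inr i.+1) by rewrite up_ge//; lia.
split=> [|z zin].
  by rewrite [in LHS]iE [in LHS]i1E insert_up (inj_eq (@up_inj j)).
case: (insertP jn zin) => [||{zin}z zin].
- by rewrite !up_lt ?insert_cupl ?up_lt//; [constructor|lia..].
- by rewrite !up_lt ?insert_cupr ?up_lt//; [constructor|lia..].
rewrite -(up_up _ ji) !insert_up -(up_up _ ji).
rewrite iE i1E !insert_up.
by case: (gcap z zin) => [->|[-> ->]|[-> ->]];
  [constructor 1|constructor 2|constructor 3].
Qed.

Lemma is_cap_insert_above n i j l g' g : i <= j -> j <= n ->
  is_cap n i l g' g -> is_cap n.+2 i l (insert j.+2 g') (insert j g).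
Proof.
move=> ij jn [<- gcap].
have iE : inr i = up j.+2 (inr i) by rewrite up_lt//; lia.
have i1E : inr i.+1 = up j.+2 (inr i.+1) by rewrite up_lt//; lia.
split=> [|z zin].
  by rewrite [in LHS]iE [in LHS]i1E insert_up (inj_eq (@up_inj _)).
case: (insertP jn zin) => [||{zin}z zin].
- by rewrite !up_ge ?insert_cupl ?up_ge//; [constructor|lia..].
- by rewrite !up_ge ?insert_cupr ?up_ge//; [constructor|lia..].
rewrite (up_up _ ij) !insert_up (up_up _ ij).
rewrite iE i1E !insert_up.
by case: (gcap z zin) => [->|[-> ->]|[-> ->]];
  [constructor 1|constructor 2|constructor 3].
Qed.

Section Gluing.
Variables (n : nat) (f g : code -> code).
Hypotheses (fP : planar 1 n f) (gP : planar 1 n g).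
Variables (D : ncpairing 1 n) (E : ncpairing n 1).
Hypotheses (Df : codes D f) (Eg : codes E (id_code \o g \o id_code)).

Let e := stacked E D.
Let bottom : spoint 1 n 1 := inl (inl ord0).
Let top : spoint 1 n 1 := inr ord0.

Lemma stacked_sym_glue : symmetric e. Proof. exact: stacked_sym. Qed.

Let conn_sym := sym_connect_sym stacked_sym_glue.

(* Otherwise [D] would be an involution without fixed point on the component
   of [bottom], and [E] one on this component without [bottom]. *)
Lemma connect_bottom_top : connect e bottom top.
Proof.
apply: contraT => ntop.
pose A := [set u | connect e bottom u].
pose lower u : spoint 1 n 1 :=
  match u with inl p => lower_point 1 (D p) | inr t => inr t end.
pose upper u : spoint 1 n 1 :=
  match u with
  | inl (inl i) => inl (inl i)
  | inl (inr j) => upper_point 1 (E (inl j))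
  | inr t => upper_point 1 (E (inr t))
  end.
have Alower : ~~ odd #|A|.
  apply: (@fixfree_even _ lower) => -[p|t]; rewrite !inE => cp /=; last first.
    by move: ntop; rewrite /top (ord1 ord0) -(ord1 t) cp.
  split; last by rewrite /lower_point pairingK.
    exact: connect_trans cp (connect1 (stacked_lower E D p)).
  by apply: contra (pairing_neq D p) => /eqP[->].
have upperP (p : bpoint n 1) : upper (upper_point 1 p) = upper_point 1 (E p).
  by case: p => j.
have upper_inj : injective (@upper_point 1 n 1) by case=> ? [] ? // [->].
have Aupper : ~~ odd #|A :\ bottom|.
  apply: (@fixfree_even _ upper) => u; rewrite !inE => /andP[ub cu].
  have [p uE] : exists p, u = upper_point 1 p.
    case: u ub {cu} => [[i|j]|t] ub; [|by exists (inl j)|by exists (inr t)].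
    by move: ub; rewrite /bottom (ord1 i) eqxx.
  rewrite uE in cu *; rewrite !upperP pairingK; split=> //; last first.
    by apply: contra (pairing_neq E p) => /eqP/upper_inj/eqP.
  by apply/andP; split;
    [case: (E p)|exact: connect_trans cu (connect1 (stacked_upper E D p))].
have bA : bottom \in A by rewrite inE connect0.
by move: Alower; rewrite (cardsD1 bottom) bA /= Aupper.
Qed.

(** The stack has one vertex more than [glue]: its top point, which lies on the component of the
    bottom point and is retracted to it. *)
Lemma n_comp_stacked : n_comp e predT = components n f g.
Proof.
pose h (p : bpoint 1 n) : spoint 1 n 1 := lower_point 1 p.
pose r (u : spoint 1 n 1) : bpoint 1 n :=
  match u with inl p => p | inr _ => inl ord0 end.
pose h' (p : bpoint 1 n) : spoint 1 n 1 := upper_point 1 (mirror_point p).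
have hh p : connect e (h p) (h' p).
  by case: p => [i|j] /=; [rewrite (ord1 i) connect_bottom_top|exact: connect0].
have mirrorE m k (p : bpoint m k) : code_of (mirror_point p) = id_code (code_of p).
  by case: p.
have mirrorK m k (p : bpoint m k) : mirror_point (mirror_point p) = p by case: p.
have idK : involutive id_code by case.
have EP (p q : bpoint 1 n) :
    code_of q = g (code_of p) <-> E (mirror_point p) = mirror_point q.
  split=> [qp|Ep].
    by apply: (@code_of_inj n 1); rewrite (codesP _ _ Eg) !mirrorE /= idK qp.
  have := codesP _ _ Eg (mirror_point p).
  by rewrite Ep !mirrorE /= idK => /(congr1 id_code); rewrite !idK.
have DP (p q : bpoint 1 n) : code_of q = f (code_of p) <-> D p = q.
  split=> [qp|<-]; last exact: codesP.
  by apply: (@code_of_inj 1 n); rewrite (codesP _ _ Df).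
apply: (@n_comp_retract _ _ _ _ predT h r) => //.
- exact: stacked_sym_glue.
- exact: glue_sym.
- move=> p q /orP[] /eqP; first by move/DP => <-; exact: connect1 (stacked_lower _ _ _).
  move=> /EP Ep; apply: (connect_trans (hh p)); rewrite -/e conn_sym.
  apply: (connect_trans (hh q)); rewrite -/e conn_sym /h' -Ep.
  exact: connect1 (stacked_upper _ _ _).
- move=> u v _ /orP[] /existsP[p /andP[/eqP-> /eqP->]].
    by apply: connect1; rewrite glueE; apply/orP; left; apply/eqP/DP.
  have rup (q : bpoint n 1) : r (upper_point 1 q) = mirror_point q.
    by case: q => [//|i]; rewrite /= (ord1 i).
  rewrite !rup; apply: connect1; rewrite glueE; apply/orP; right.
  by apply/eqP/EP; rewrite !mirrorK.
- move=> [p|t] _; first exact: connect0.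
  by rewrite (ord1 t) -/e conn_sym connect_bottom_top.
Qed.

(** The predecessor discards the strand from bottom to top, the one component that is not a loop. *)
Lemma loops_stacked : loops E D = (components n f g).-1.
Proof.
rewrite -n_comp_stacked (n_compC (connect e bottom)) (n_comp_connect conn_sym).
rewrite add1n /=; apply: eq_n_comp_r => u; rewrite [in RHS]inE /= inE.
apply/forallP/negP => [uN bu|buN p]; last first.
  apply/negP => up; apply: buN; rewrite inE conn_sym.
  have pb : connect e (outer_point n p) bottom.
    case: {up}p => i; rewrite /= (ord1 i); first exact: connect0.
    by rewrite conn_sym connect_bottom_top.
  exact: connect_trans up pb.
by have := uN (inl ord0); rewrite /= -/bottom -/e conn_sym; case/negP.
Qed.

Lemma stack_stacked (G : ncpairing 1 1) : stack_pairing E D G.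
Proof.
apply/forallP => -[i|i]; have := pairing_neq G (_ i);
  [move/(_ (@inl _ _))|move/(_ (@inr _ _))]; case: (G _) => j;
  rewrite (ord1 i) (ord1 j) ?eqxx//= => _; rewrite -/e.
- exact: connect_bottom_top.
- by rewrite -/e conn_sym; exact: connect_bottom_top.
Qed.

End Gluing.

(** * The sesquilinear form on diagrams *)

Section InnerProduct.
Variable R : realType.
Local Notation C := R[i].
Local Open Scope ring_scope.
Variable delta : R.

Lemma rdagger_diag m n f : planar m n f ->
  rdagger (diag R m n f) = diag R n m (id_code \o f \o id_code).
Proof.
move=> fP; apply/ffunP => G; have [D Df] := codes_exists fP.
rewrite (diag_codes _ Df) !ffunE big_mkcond (bigD1 D)//= [X in _ + X]big1 ?addr0.
  rewrite ffunE eqxx conjC1.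
  suff -> : mirror_image D G = codes G (id_code \o f \o id_code) by case: codes.
  have mirrorE a b (p : bpoint a b) : code_of (mirror_point p) = id_code (code_of p).
    by case: p.
  have mirrorK a b (p : bpoint a b) : mirror_point (mirror_point p) = p by case: p.
  have idK : involutive id_code by case.
  apply/forallP/codesP => [DG p|GE p].
    rewrite -[p]mirrorK (eqP (DG _)) !mirrorE (codesP _ _ Df) /=.
    by rewrite mirrorE idK.
  apply/eqP; apply: code_of_inj.
  by rewrite GE /= !mirrorE idK (codesP _ _ Df).
by move=> D' /negPf D'D; rewrite ffunE D'D conjC0; case: ifP.
Qed.

Lemma rdot_diag n f g : planar 1 n f -> planar 1 n g ->
  rdot delta (diag R 1 n f) (diag R 1 n g) =
  delta%:C%C ^+ (components n f g).-1.
Proof.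
move=> fP gP; rewrite /rdot rdagger_diag// /rscalar.
have [D Df] := codes_exists fP; have [E Eg] := codes_exists (planar_mirror gP).
have [G _] := codes_exists (planar_id 1).
rewrite (bigD1 G)//= [X in _ + X]big1 ?addr0; last first.
  move=> G' /eqP; case; apply/val_inj/ffunP => p.
  have := pairing_neq G p; have := pairing_neq G' p.
  by case: p (G p) (G' p) => i [] j [] k //=;
    rewrite ?(ord1 i) ?(ord1 j) ?(ord1 k) ?eqxx.
rewrite (diag_codes _ Df) (diag_codes _ Eg) !ffunE.
rewrite (bigD1 E)//= [X in _ + X]big1 ?addr0; last first.
  by move=> E' /negPf E'E; rewrite big1// => D' _; rewrite !ffunE E'E mulr0 mul0r.
rewrite (bigD1 D)/=; last exact: stack_stacked.
rewrite [X in _ + X]big1 ?addr0; last first.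
  by move=> D' /andP[_ /negPf D'D]; rewrite !ffunE D'D mulr0.
by rewrite !ffunE !eqxx !mulr1 (loops_stacked fP gP Df Eg).
Qed.

Lemma rdaggerD m n (x y : Rec R m n) : rdagger (x + y) = rdagger x + rdagger y.
Proof.
apply/ffunP => G; rewrite !ffunE -big_split/=; apply: eq_bigr => D _.
by rewrite !ffunE rmorphD.
Qed.

Lemma rdaggerZ m n (c : C) (x : Rec R m n) :
  rdagger (c *: x) = Num.conj c *: rdagger x.
Proof.
apply/ffunP => G; rewrite !ffunE scaler_sumr; apply: eq_bigr => D _.
by rewrite !ffunE /GRing.scale /= rmorphM.
Qed.

Lemma rdotDl n (x x' y : Rec R 1 n) :
  rdot delta (x + x') y = rdot delta x y + rdot delta x' y.
Proof.
by rewrite /rdot rcompDr /rscalar -big_split/=; apply: eq_bigr => G _; rewrite ffunE.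
Qed.

Lemma rdotZl n (c : C) (x y : Rec R 1 n) :
  rdot delta (c *: x) y = c * rdot delta x y.
Proof.
by rewrite /rdot rcompZr /rscalar mulr_sumr; apply: eq_bigr => G _; rewrite ffunE.
Qed.

Lemma rdotDr n (x y y' : Rec R 1 n) :
  rdot delta x (y + y') = rdot delta x y + rdot delta x y'.
Proof.
rewrite /rdot rdaggerD rcompDl /rscalar -big_split/=.
by apply: eq_bigr => G _; rewrite ffunE.
Qed.

Lemma rdotZr n (c : C) (x y : Rec R 1 n) :
  rdot delta x (c *: y) = Num.conj c * rdot delta x y.
Proof.
rewrite /rdot rdaggerZ rcompZl /rscalar mulr_sumr.
by apply: eq_bigr => G _; rewrite ffunE.
Qed.

End InnerProduct.

(** * Vacuum coefficients *)

(* The diagram obtained by inserting cups, the head of the word last. *)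
Definition insertions (w : seq nat) (f : code -> code) : code -> code :=
  foldr insert f w.

Fixpoint insertable n (w : seq nat) : bool :=
  if w is i :: w' then (i <= n + (size w').*2) && insertable n w' else true.

Lemma planar_insertions m n w f : planar m n f -> insertable n w ->
  planar m (n + (size w).*2) (insertions w f).
Proof.
move=> fP; elim: w => [|i w IHw] /=; first by rewrite addn0.
case/andP=> iw /IHw wP.
have -> : n + (size w).+1.*2 = (n + (size w).*2).+2 by lia.
exact: planar_insert.
Qed.

Lemma components_gt0 n f g : planar 1 n f -> planar 1 n g -> 0 < components n f g.
Proof.
move=> fP gP; rewrite /components.
rewrite (n_compC (connect (glue n f g) (inl ord0))) n_comp_connect//.
exact/sym_connect_sym/glue_sym.
Qed.

(* Joining the top points [i] and [i.+1] of a word of cups: whether this closes a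
   loop, and the remaining word. *)
Fixpoint cap_word i (w : seq nat) : option (bool * seq nat) :=
  if w is j :: w' then
    if i == j then Some (true, w')
    else if (i.+1 == j) || (i == j.+1) then Some (false, w')
    else if i < j then
      if cap_word i w' is Some (l, u) then Some (l, j.-2 :: u) else None
    else if cap_word i.-2 w' is Some (l, u) then Some (l, j :: u) else None
  else None.

(** The shift [p] carries the word of a small tree to its place in a larger diagram. As [cap_word]
    only compares positions, it is evaluated on the unshifted word. *)
Lemma cap_wordP p n i w l u g : cap_word i w = Some (l, u) -> planar 1 n g ->
  insertable n (map (addn p) w) -> p + i <= n + (size w).-1.*2 ->
  [/\ size w = (size u).+1, insertable n (map (addn p) u) &
      is_cap (n + (size u).*2) (p + i) l
        (insertions (map (addn p) w) g) (insertions (map (addn p) u) g)].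
Proof.
move=> + gP; elim: w i l u => [//|j w IHw] i l u /=; rewrite size_map.
have [->|ij] := eqVneq i j.
  by move=> [<- <-] /andP[_ wn] _ /=; split=> //; exact: is_cap_insert.
case: ifP => [ij1 [<- <-]|ij1 + /andP[jn wn] iln] /=.
  move=> /andP[jn wn] iln; have wP := planar_insertions gP wn.
  rewrite size_map in wP; split=> //.
  case/orP: ij1 => /eqP ij1.
    by rewrite -ij1 addnS; apply: is_cap_insertS => //; lia.
  by rewrite ij1 addnS; apply: is_cap_insert_pred => //; lia.
case: ifP => ij2; case E: cap_word => [[l' u']|//] [<- <-] /=.
  have w0 : 0 < size w by case: (w) E.
  have [||sw un cap] := IHw _ _ _ E; [by []|by lia|].
  rewrite size_map sw; split=> //; first by rewrite un andbT; lia.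
  have -> : n + (size u').+1.*2 = (n + (size u').*2).+2 by lia.
  have -> : p + j = (p + j.-2).+2 by lia.
  by apply: is_cap_insert_above => //; lia.
have w0 : 0 < size w by case: (w) E.
have [||sw un cap] := IHw _ _ _ E; [by []|by lia|].
rewrite size_map sw; split=> //; first by rewrite un andbT; lia.
have -> : n + (size u').+1.*2 = (n + (size u').*2).+2 by lia.
have -> : p + i = (p + i.-2).+2 by lia.
by apply: is_cap_insert_below => //; lia.
Qed.

(** The value [None] signals a cap that meets no cup, when the count would depend on the diagrams
    below the words. *)
Fixpoint closed_loops (w w' : seq nat) : option nat :=
  if w is i :: u then
    if cap_word i w' is Some (l, u') then
      if closed_loops u u' is Some k then Some (l + k) else None
    else None
  else Some 0.

(** The isolation of a leaf: every cap from [w] is consumed by a cup of [w'], so [f] and [g] are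
    left as they were and the count is a sum. *)
Lemma closed_loopsP w w' k p n f g :
  closed_loops w w' = Some k -> size w = size w' ->
  planar 1 n f -> planar 1 n g ->
  insertable n (map (addn p) w) -> insertable n (map (addn p) w') ->
  components (n + (size w).*2) (insertions (map (addn p) w) f)
    (insertions (map (addn p) w') g) = k + components n f g.
Proof.
move=> + + fP gP; elim: w w' k => [|i u IHu] w' k /=.
  by move=> [<-]; case: w' => //= _ _ _; rewrite addn0.
case capE : cap_word => [[l u']|//]; case kE : closed_loops => [k'|//] [<-].
move=> sw' /andP[iu un] w'n; rewrite size_map in iu.
have iw' : p + i <= n + (size w').-1.*2 by rewrite -sw'.
have [sw'E u'n cap] := cap_wordP capE gP w'n iw'.
have su : size u = size u' by apply: succn_inj; rewrite sw' sw'E.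
have w'P := planar_insertions gP w'n; have uP := planar_insertions fP un.
have u'P := planar_insertions gP u'n; rewrite !size_map -?su in w'P uP u'P cap.
have nE : n + (size u).+1.*2 = (n + (size u).*2).+2 by lia.
rewrite -addnA -(IHu _ _ kE su un u'n) nE.
by apply: components_cap => //; rewrite -nE sw'.
Qed.

Section Expansion.
Variable R : realType.
Local Notation C := R[i].
Local Open Scope ring_scope.

(* The terms of [labelings]: the exponents of [a] and [b], and the cups. *)
Fixpoint expansion (w : seq nat) : seq (nat * nat * seq nat) :=
  if w is k :: w' then
    [seq (t.1.1.+1, t.1.2, rcons t.2 k.*2.+1) | t <- expansion w'] ++
    [seq (t.1.1, t.1.2.+1, rcons t.2 k.*2) | t <- expansion w']
  else [:: (0, 0, [::])%N].

Lemma labelings_expansion (a b : C) (L : lmodType C) (F : (code -> code) -> L) q w f :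
  labelings a b F (map (addn q) w) f =
  \sum_(t <- expansion w) (a ^+ t.1.1 * b ^+ t.1.2) *:
     F (insertions (map (addn q.*2) t.2) f).
Proof.
elim: w f => [|k w IHw] f /=; first by rewrite big_seq1 /= !expr0 mulr1 scale1r.
rewrite !IHw big_cat !big_map !scaler_sumr; congr (_ + _).
  apply: eq_bigr => t _; rewrite scalerA mulrA -exprS map_rcons /insertions.
  by rewrite foldr_rcons doubleD addnS.
apply: eq_bigr => t _; rewrite scalerA mulrCA -exprS map_rcons /insertions.
by rewrite foldr_rcons doubleD.
Qed.

Definition pairing_terms (w w' : seq nat) : seq (nat * nat * option nat) :=
  [seq ((t.1.1 + t'.1.1)%N, (t.1.2 + t'.1.2)%N,
        closed_loops t.2 t'.2)
  | t <- expansion w, t' <- expansion w'].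

(** For real parameters and pairable words of trees this is the inner product of the two tree
    vectors, expanded over pairs of words of cups. The default value never occurs for pairable
    words. *)
Definition vacuum_coef (delta a b : C) (w w' : seq nat) : C :=
  \sum_(t <- pairing_terms w w') a ^+ t.1.1 * b ^+ t.1.2 * delta ^+ odflt 0%N t.2.

(* The checks that make [vacuum_coef] meaningful. *)
Definition pairable (w w' : seq nat) : bool :=
  [&& size w == size w', all (fun t => isSome t.2) (pairing_terms w w'),
      all (fun t => (size t.2 == size w) && insertable 1 t.2) (expansion w)
    & all (fun t => (size t.2 == size w') && insertable 1 t.2) (expansion w')].

Lemma insertable_shift n p w : (p < n)%N -> insertable 1 w ->
  insertable n (map (addn p) w).
Proof.
move=> pn; elim: w => //= i w IHw /andP[iw /IHw->]; rewrite andbT size_map; lia.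
Qed.

Lemma rdot_suml (delta : R) n I (s : seq I) (F : I -> Rec R 1 n) y :
  rdot delta (\sum_(i <- s) F i) y = \sum_(i <- s) rdot delta (F i) y.
Proof.
elim/big_rec2: _ => [|i x z _ <-]; last by rewrite rdotDl.
by rewrite -[X in rdot _ X](scale0r (0 : Rec R 1 n)) rdotZl mul0r.
Qed.

Lemma rdot_sumr (delta : R) n I (s : seq I) (F : I -> Rec R 1 n) x :
  rdot delta x (\sum_(i <- s) F i) = \sum_(i <- s) rdot delta x (F i).
Proof.
elim/big_rec2: _ => [|i y z _ <-]; last by rewrite rdotDr.
by rewrite -[X in rdot _ _ X](scale0r (0 : Rec R 1 n)) rdotZr conjC0 mul0r.
Qed.

(** In every pair of terms the loop count is a number depending on the words plus the count for [f]
    and [g]; the latter gives a common factor. *)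
Lemma rdot_labelings (delta a b : R) n N q w w' f g :
  pairable w w' -> planar 1 n f -> planar 1 n g -> (q.*2 < n)%N ->
  N = (n + (size w).*2)%N ->
  rdot delta (labelings a%:C%C b%:C%C (diag R 1 N) (map (addn q) w) f)
    (labelings a%:C%C b%:C%C (diag R 1 N) (map (addn q) w') g) =
  vacuum_coef delta%:C%C a%:C%C b%:C%C w w' *
  rdot delta (diag R 1 n f) (diag R 1 n g).
Proof.
case/and4P=> /eqP ww' /allP ok /allP wok /allP w'ok fP gP qn ->.
rewrite !labelings_expansion rdot_suml rdot_diag// /vacuum_coef big_allpairs_dep.
rewrite mulr_suml big_seq [RHS]big_seq; apply: eq_bigr => t tw.
rewrite rdot_sumr mulr_suml big_seq [RHS]big_seq; apply: eq_bigr => t' tw'.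
have /andP[/eqP st tn] := wok _ tw; have /andP[/eqP st' tn'] := w'ok _ tw'.
have : ((t.1.1 + t'.1.1)%N, (t.1.2 + t'.1.2)%N,
    closed_loops t.2 t'.2) \in pairing_terms w w'.
  by apply/allpairsP; exists (t, t').
move/ok; case lE : closed_loops => [l|//] _.
have tP := insertable_shift qn tn; have tP' := insertable_shift qn tn'.
have tt' : size t.2 = size t'.2 by rewrite st st'.
rewrite rdotZl rdotZr rdot_diag; last 2 first.
- by rewrite -st; have := planar_insertions fP tP; rewrite size_map.
- by rewrite ww' -st'; have := planar_insertions gP tP'; rewrite size_map.
rewrite -st (closed_loopsP lE tt' fP gP tP tP').
(* The closed strand through the bottom point belongs to the components of [f] and [g], so the
   predecessor can be taken there. *)
have -> : (l + components n f g).-1 = (l + (components n f g).-1)%N.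
  by have := components_gt0 fP gP; lia.
rewrite /= !exprD rmorphM !rmorphXn /=.
have conjE (c : R) : Num.conj (c%:C%C : C) = c%:C%C.
  by apply: conj_Creal; rewrite complex_real.
rewrite !conjE.
by ring.
Qed.

End Expansion.

(** * Interchange of branchings and functoriality *)

Section Interchange.
Variable R : realType.
Local Notation C := R[i].
Local Open Scope ring_scope.
Variables (a b : C).

Definition extensional (L : Type) (F : (code -> code) -> L) : Prop :=
  forall f g, f =1 g -> F f = F g.

Lemma labelings_ext (L : lmodType C) (F : (code -> code) -> L) w :
  extensional F -> extensional (labelings a b F w).
Proof.
by move=> Fext; elim: w => //= k w IHw f g fg; congr (_ *: _ + _ *: _);
  apply: IHw; exact: eq_insert.
Qed.

Lemma labelings_cat (L : lmodType C) (F : (code -> code) -> L) w w' f :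
  labelings a b F (w ++ w') f = labelings a b (labelings a b F w') w f.
Proof. by elim: w f => //= k w IHw f; rewrite !IHw. Qed.

(** Quantifying over [L] and [F] lets the tail of a word be absorbed into [F]; this yields
    compatibility with concatenation. *)
Definition interchange (w w' : seq nat) : Prop :=
  forall (L : lmodType C) (F : (code -> code) -> L), extensional F ->
  labelings a b F w =1 labelings a b F w'.

Lemma interchange_refl w : interchange w w. Proof. by []. Qed.

Lemma interchange_trans w2 w1 w3 :
  interchange w1 w2 -> interchange w2 w3 -> interchange w1 w3.
Proof. by move=> h12 h23 L F Fext f; rewrite h12// h23. Qed.

Lemma interchange_cat w1 w1' w2 w2' :
  interchange w1 w1' -> interchange w2 w2' -> interchange (w1 ++ w2) (w1' ++ w2').
Proof.
move=> h1 h2 L F Fext f; rewrite !labelings_cat h1; last exact: labelings_ext.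
elim: w1' f {h1} => [|k w IHw] f /=; first exact: h2.
by rewrite !IHw.
Qed.

Lemma interchange_swap i j : (i < j)%N -> interchange [:: j; i] [:: i; j.+1].
Proof.
move=> ij L F Fext f /=.
(* The offsets [e] and [e'] encode the side of the cup at each of the two roots: 0 for left, 1 for
   right. *)
have swap e e' : (e <= 1)%N -> F (insert (i.*2 + e) (insert (j.*2 + e') f)) =
    F (insert (j.*2.+2 + e') (insert (i.*2 + e) f)).
  move=> e1; apply: Fext => x; rewrite insert_insert//; lia.
have := swap 0 0 isT; have := swap 0 1 isT; have := swap 1 0 isT; have := swap 1 1 isT.
rewrite !addn0 !addn1 doubleS => -> -> -> ->.
by rewrite !scalerDr !scalerA addrACA [b * a]mulrC.
Qed.

Lemma interchange_step i w : all (leq i.+1) w ->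
  interchange (rcons w i) (i :: map S w).
Proof.
elim: w => [_|j w IHw] /=; first exact: interchange_refl.
case/andP=> ij /IHw{}IHw; apply: (@interchange_trans (j :: i :: map S w)).
  exact: (interchange_cat (interchange_refl [:: j]) IHw).
exact: (interchange_cat (interchange_swap ij) (interchange_refl (map S w))).
Qed.

End Interchange.

Lemma leaves_gt0 t : 0 < leaves t.
Proof. by elim: t => //= l IHl r IHr; lia. Qed.

Lemma growth_shift m k t : growth (m + k) t = map (addn m) (growth k t).
Proof.
elim: t k => //= l IHl r IHr k.
by rewrite map_cat -IHl -IHr addnA.
Qed.

Lemma size_growth k t : size (growth k t) = (leaves t).-1.
Proof.
elim: t k => //= l IHl r IHr k; rewrite size_cat IHl IHr.
by have := leaves_gt0 l; have := leaves_gt0 r; lia.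
Qed.

Lemma growth_ge k t : all (leq k) (growth k t).
Proof.
elim: t k => //= l IHl r IHr k; rewrite leqnn all_cat IHl /=.
by apply: sub_all (IHr _) => x; lia.
Qed.

Definition forest_leaves (q : seq tree) : nat := sumn (map leaves q).

Lemma size_forest_leaves q : size q <= forest_leaves q.
Proof.
by rewrite /forest_leaves; elim: q => //= t q; have := leaves_gt0 t; lia.
Qed.

Lemma forest_growth_cat k q q' : forest_growth k (q ++ q') =
  forest_growth k q ++ forest_growth (k + forest_leaves q) q'.
Proof.
elim: q k => [|t q IHq] k /=; first by rewrite addn0.
by rewrite IHq catA -addnA.
Qed.

Lemma leaves_graft q t : size q = leaves t -> leaves (graft q t) = forest_leaves q.
Proof.
elim: t q => [|l IHl r IHr] q /=.
  by case: q => [|t []]//=; rewrite /forest_leaves /= addn0.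
move=> sq; rewrite IHl ?size_takel ?sq ?leq_addr//.
rewrite IHr ?size_drop ?sq ?addKn//.
by rewrite /forest_leaves -sumn_cat -map_cat cat_take_drop.
Qed.

Section Functoriality.
Variable R : realType.
Local Notation C := R[i].
Variables (a b : C).
Local Notation inter := (interchange a b).

(** Induction on the tree: the root branching passes below [w] by [interchange_step], then the left
    subtree, then the right one; each new leaf pushes the roots on its right by one. *)
Lemma interchange_growth i t w : all (leq i.+1) w ->
  inter (w ++ growth i t) (growth i t ++ map (addn (leaves t).-1) w).
Proof.
elim: t i w => [|l IHl r IHr] i w iw /=.
  by rewrite cats0 map_id_in.
set ll := leaves l; set lr := leaves r.
have l0 : 0 < ll := leaves_gt0 l; have r0 : 0 < lr := leaves_gt0 r.
rewrite -cat_rcons.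
apply: (interchange_trans (interchange_cat (interchange_step _ _ iw)
  (interchange_refl _ _ _))).
rewrite -cat1s -[X in inter _ X]cat1s -catA.
apply: interchange_cat; first exact: interchange_refl.
rewrite catA.
apply: (@interchange_trans _ _ _
  ((growth i l ++ map (addn ll.-1) (map S w)) ++ growth (i + ll) r)).
  apply: interchange_cat; last exact: interchange_refl.
  by apply: IHl; rewrite all_map; apply: sub_all iw => x /=; lia.
rewrite -!catA; apply: interchange_cat; first exact: interchange_refl.
have -> : map (addn (ll + lr).-1) w =
    map (addn lr.-1) (map (addn ll.-1) (map S w)).
  by rewrite -!map_comp; apply: eq_map => x /=; lia.
by apply: IHr; rewrite -map_comp all_map; apply: sub_all iw => x /=; lia.
Qed.

Lemma interchange_forest k q w : all (leq (k + size q)) w ->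
  inter (w ++ forest_growth k q)
    (forest_growth k q ++ map (addn (forest_leaves q - size q)) w).
Proof.
elim: q k w => [|t q IHq] k w kw /=.
  by rewrite cats0 map_id_in.
have t0 := leaves_gt0 t; have q0 := size_forest_leaves q.
rewrite catA; apply: (@interchange_trans _ _ _
  ((growth k t ++ map (addn (leaves t).-1) w) ++ forest_growth (k + leaves t) q)).
  apply: interchange_cat; last exact: interchange_refl.
  by apply: interchange_growth; apply: sub_all kw => x /=; lia.
rewrite -!catA; apply: interchange_cat; first exact: interchange_refl.
have -> : map (addn (forest_leaves (t :: q) - (size q).+1)) w =
    map (addn (forest_leaves q - size q)) (map (addn (leaves t).-1) w).
  rewrite -map_comp; apply: eq_map => x /=.
  by rewrite {1}/forest_leaves /= -/(forest_leaves q); lia.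
by apply: IHq; rewrite all_map; apply: sub_all kw => x /=; lia.
Qed.

(** [growth] proceeds depth first, so in the grafted tree all that stands over the left subtree
    comes before the right subtree. *)
Lemma interchange_graft k q t : size q = leaves t ->
  inter (growth k t ++ forest_growth k q) (growth k (graft q t)).
Proof.
elim: t k q => [|l IHl r IHr] k q /=.
  by case: q => [|t []]//= _; rewrite cats0; exact: interchange_refl.
move=> sq; set q1 := take _ q; set q2 := drop _ q.
have s1 : size q1 = leaves l by rewrite size_takel// sq leq_addr.
have s2 : size q2 = leaves r by rewrite size_drop sq addKn.
rewrite -cat1s -[X in inter _ X]cat1s.
apply: interchange_cat; first exact: interchange_refl.
rewrite -(cat_take_drop (leaves l) q) -/q1 -/q2 forest_growth_cat -catA.
have h := size_forest_leaves q1.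
have rE : growth (k + forest_leaves q1) r =
    map (addn (forest_leaves q1 - size q1)) (growth (k + leaves l) r).
  by rewrite -growth_shift; congr growth; lia.
(* The forest over the left subtree is moved below the branchings of the right subtree. *)
apply: (@interchange_trans _ _ _ (growth k l ++ (forest_growth k q1 ++
  growth (k + forest_leaves q1) r) ++ forest_growth (k + forest_leaves q1) q2)).
  apply: interchange_cat; first exact: interchange_refl.
  rewrite catA; apply: interchange_cat; last exact: interchange_refl.
  rewrite rE; apply: interchange_forest; rewrite s1; exact: growth_ge.
rewrite catA catA -[X in inter X _]catA leaves_graft//.
apply: interchange_cat; [exact: IHl|exact: IHr].
Qed.

End Functoriality.

Lemma fits_cat n w w' : fits n (w ++ w') = fits n w && fits (n + (size w).*2) w'.
Proof.
elim: w n => [|k w IHw] n /=; first by rewrite addn0.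
by rewrite IHw andbA; congr (_ && fits _ _); lia.
Qed.

Lemma fits_growth n k t : k.*2 < n -> fits n (growth k t).
Proof.
elim: t n k => //= l IHl r IHr n k kn; rewrite kn /= fits_cat IHl; last by lia.
by rewrite size_growth IHr//; have := leaves_gt0 l; lia.
Qed.

Lemma fits_forest n k q : (k + size q).*2 <= n.+1 -> fits n (forest_growth k q).
Proof.
elim: q n k => //= t q IHq n k kn.
rewrite fits_cat fits_growth ?size_growth; last by lia.
by apply: IHq; have := leaves_gt0 t; lia.
Qed.

Lemma size_forest_growth k q : size (forest_growth k q) = forest_leaves q - size q.
Proof.
elim: q k => //= t q IHq k; rewrite size_cat IHq size_growth.
by rewrite [in RHS]/forest_leaves /= -/(forest_leaves q);
  have := leaves_gt0 t; have := size_forest_leaves q; lia.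
Qed.

(** * The spans of tree vectors *)

Section Spans.
Variable R : realType.
Local Notation C := R[i].
Local Open Scope ring_scope.
Variables (delta : R) (a b : C).

Lemma Phi_labelings n m q : (0 < n)%N -> size q = n -> m = forest_leaves q ->
  Phi delta a b n m q =
  labelings a b (diag R (strands n) (strands m)) (forest_growth 0 q) id_code.
Proof.
case: n => // n _ sq ->; rewrite /Phi Phi_growth_labelings//.
  by apply: fits_forest; rewrite sq /strands; lia.
by rewrite size_forest_growth sq; have := size_forest_leaves q; lia.
Qed.

Lemma Phi_diag n m q f : (0 < n)%N -> size q = n -> m = forest_leaves q ->
  planar 1 (strands n) f ->
  rcomp delta (Phi delta a b n m q) (diag R 1 (strands n) f) =
  labelings a b (diag R 1 (strands m)) (forest_growth 0 q) f.
Proof.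
move=> n0 sq mq fP; rewrite Phi_labelings//.
apply: (rcomp_labelings _ _ _ (planar_id _) (@upward_id _) fP fP).
- by move=> x; rewrite compose_id.
- by apply: fits_forest; rewrite sq /strands; lia.
- rewrite size_forest_growth sq mq /strands.
  by have := size_forest_leaves q; lia.
Qed.

Lemma labelings_ind n N w f (Pr : Rec R 1 N -> Prop) :
  (forall x y c d, Pr x -> Pr y -> Pr (c *: x + d *: y)) ->
  (forall g, planar 1 N g -> Pr (diag R 1 N g)) ->
  planar 1 n f -> fits n w -> N = (n + (size w).*2)%N ->
  Pr (labelings a b (diag R 1 N) w f).
Proof.
move=> Plin Pdiag; elim: w n f => [|k w IHw] n f fP /=.
  by rewrite addn0 => _ NE; apply: Pdiag; rewrite NE.
case/andP=> kn wn NE; apply: Plin; apply: (IHw n.+2) => //; try by lia.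
- by apply: planar_insert.
- by apply: planar_insert => //; lia.
Qed.

Lemma Phi_tree_ind n t (Pr : Rec R 1 (strands n) -> Prop) :
  (forall x y c d, Pr x -> Pr y -> Pr (c *: x + d *: y)) ->
  (forall g, planar 1 (strands n) g -> Pr (diag R 1 (strands n) g)) ->
  leaves t = n -> Pr (Phi delta a b 1 n [:: t] : Rec R 1 (strands n)).
Proof.
move=> Plin Pdiag tn; rewrite Phi_labelings//= ?cats0; last first.
  by rewrite /forest_leaves /= addn0.
apply: (@labelings_ind 1) => //.
- exact: planar_id.
- exact: fits_growth.
- by rewrite size_growth tn /strands; have := leaves_gt0 t; lia.
Qed.

Lemma rcomp_sumr m k n I (s : seq I) (F : I -> Rec R m k) (x : Rec R k n) :
  rcomp delta x (\sum_(i <- s) F i) = \sum_(i <- s) rcomp delta x (F i).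
Proof.
elim/big_rec2: _ => [|i y z _ <-]; last by rewrite rcompDr.
by rewrite -[X in rcomp _ _ X](scale0r (0 : Rec R m k)) rcompZr scale0r.
Qed.

(** Tree vectors are combinations of planar diagrams, so an identity that is linear or antilinear in
    [xi] may be checked on single diagrams. *)
Lemma Phi_span_ind n (Pr : Rec R 1 (strands n) -> Prop) :
  (forall x y c d, Pr x -> Pr y -> Pr (c *: x + d *: y)) -> Pr 0 ->
  (forall g, planar 1 (strands n) g -> Pr (diag R 1 (strands n) g)) ->
  forall xi, Phi_span delta a b xi -> Pr xi.
Proof.
move=> Plin P0 Pdiag _ [l [ln ->]].
elim: l ln => [|[c t] l IHl] /=; first by rewrite big_nil.
case/andP=> /eqP tn /IHl Pl; rewrite big_cons /= -[X in _ + X]scale1r.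
by apply: (Plin) => //; exact: (Phi_tree_ind Plin Pdiag tn).
Qed.

Lemma rcomp_labelings2 n N M w q f : planar 1 n f -> fits n w ->
  N = (n + (size w).*2)%N -> fits N q -> M = (N + (size q).*2)%N ->
  rcomp delta (labelings a b (diag R N M) q id_code)
    (labelings a b (diag R 1 N) w f) = labelings a b (diag R 1 M) (w ++ q) f.
Proof.
elim: w n f => [|k w IHw] n f fP /=.
  rewrite addn0; move=> _ NE; rewrite -NE in fP; move=> qn ME.
  apply: (rcomp_labelings _ _ _ (planar_id _) (@upward_id _) fP fP) => //.
  by move=> x; rewrite compose_id.
case/andP=> kn wn NE qN ME; rewrite rcompDr !rcompZr !(IHw n.+2)//; try by lia.
- by apply: planar_insert => //; lia.
- exact: planar_insert.
Qed.

Lemma extensional_diag m n : extensional (diag R m n).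
Proof. by move=> f g; exact: eq_diag. Qed.

(** Both sides build the same tree, with the branchings in different orders. This makes the spans
    stable under the connecting maps. *)
Lemma Phi_graft n m q t : size q = n -> leaves t = n -> m = forest_leaves q ->
  rcomp delta (Phi delta a b n m q) (Phi delta a b 1 n [:: t]) =
  Phi delta a b 1 m [:: graft q t].
Proof.
move=> sq tn mq; have n0 : (0 < n)%N by rewrite -tn leaves_gt0.
rewrite !Phi_labelings//= ?cats0 /forest_leaves/= ?addn0 ?leaves_graft ?sq//.
have t0 := leaves_gt0 t; have ql := size_forest_leaves q.
rewrite (@rcomp_labelings2 1).
- apply: interchange_graft; first by rewrite sq.
  exact: extensional_diag.
- exact: planar_id.
- exact: fits_growth.
- by rewrite size_growth /strands; lia.
- by apply: fits_forest; rewrite sq /strands; lia.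
- by rewrite size_forest_growth /strands; lia.
Qed.

Lemma Phi_span_Phi n m q (xi : Rec R 1 (strands n)) : size q = n ->
  m = forest_leaves q -> Phi_span delta a b xi ->
  Phi_span delta a b (rcomp delta (Phi delta a b n m q) xi).
Proof.
move=> sq mq [l [ln ->]]; exists [seq (p.1, graft q p.2) | p <- l]; split.
  elim: l ln => //= -[c t] l IHl /= /andP[/eqP tn /IHl ->].
  by rewrite andbT leaves_graft ?mq// tn.
rewrite rcomp_sumr big_map; elim: l ln => [|[c t] l IHl] /=; first by rewrite !big_nil.
case/andP=> /eqP tn /IHl lE; rewrite !big_cons /= lE rcompZr.
by congr (_ *: _ + _); exact: Phi_graft.
Qed.

End Spans.

Definition plant n k s : seq tree :=
  nseq k Leaf ++ s :: nseq (n - k.+1) Leaf.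

Lemma size_plant n k s : k < n -> size (plant n k s) = n.
Proof. by move=> kn; rewrite size_cat /= !size_nseq; lia. Qed.

Lemma forest_leaves_nseq n : forest_leaves (nseq n Leaf) = n.
Proof. by rewrite /forest_leaves map_nseq sumn_nseq mul1n. Qed.

Lemma forest_leaves_plant n k s : k < n ->
  forest_leaves (plant n k s) = n.-1 + leaves s.
Proof.
move=> kn; rewrite /plant /forest_leaves map_cat sumn_cat /=.
have := forest_leaves_nseq; rewrite /forest_leaves => E; rewrite !E; lia.
Qed.

Lemma forest_growth_nseq k n : forest_growth k (nseq n Leaf) = [::].
Proof. by elim: n k => //= n IHn k. Qed.

Lemma forest_growth_plant n k s :
  forest_growth 0 (plant n k s) = map (addn k) (growth 0 s).
Proof.
rewrite forest_growth_cat /= !forest_growth_nseq cats0 forest_leaves_nseq.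
by rewrite add0n -growth_shift addn0.
Qed.

Section VacuumCoefficient.
Variable R : realType.
Local Notation C := R[i].
Local Open Scope ring_scope.
Variables (delta a b : R).

(** Planting at root [k] shifts the cups of [s] and [t] by [k.*2]; on single diagrams this is the
    situation of [rdot_labelings]. *)
Lemma rdot_plant n m k s t (xi eta : Rec R 1 (strands n)) :
  pairable (growth 0 s) (growth 0 t) -> (k < n)%N -> m = (n.-1 + leaves s)%N ->
  Phi_span delta a%:C%C b%:C%C xi -> Phi_span delta a%:C%C b%:C%C eta ->
  rdot delta (rcomp delta (Phi delta a%:C%C b%:C%C n m (plant n k s)) xi)
    (rcomp delta (Phi delta a%:C%C b%:C%C n m (plant n k t)) eta) =
  vacuum_coef delta%:C%C a%:C%C b%:C%C (growth 0 s) (growth 0 t) *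
    rdot delta xi eta.
Proof.
move=> st kn mE xis etas; have n0 : (0 < n)%N by lia.
have stl : leaves s = leaves t.
  have /and4P[/eqP + _ _ _] := st; rewrite !size_growth.
  by have := leaves_gt0 s; have := leaves_gt0 t; lia.
have rcomp0 j l (x : Rec R j l) p : rcomp delta x (0 : Rec R p j) = 0.
  by rewrite -[X in rcomp _ _ X](scale0r (0 : Rec R p j)) rcompZr scale0r.
have rdot0l l (y : Rec R 1 l) : rdot delta 0 y = 0.
  by rewrite -[X in rdot _ X](scale0r (0 : Rec R 1 l)) rdotZl mul0r.
have rdot0r l (y : Rec R 1 l) : rdot delta y 0 = 0.
  by rewrite -[X in rdot _ _ X](scale0r (0 : Rec R 1 l)) rdotZr conjC0 mul0r.
move: xi xis; apply: Phi_span_ind.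
- move=> x y c d hx hy; rewrite rcompDr !rcompZr !rdotDl !rdotZl hx hy.
  by rewrite mulrDr ![_ * (vacuum_coef _ _ _ _ _ * _)]mulrCA.
- by rewrite rcomp0 !rdot0l mulr0.
move=> f fP; move: eta etas; apply: Phi_span_ind.
- move=> x y c d hx hy; rewrite [in LHS]rcompDr !rcompZr !rdotDr !rdotZr hx hy.
  by rewrite mulrDr ![_ * (vacuum_coef _ _ _ _ _ * _)]mulrCA.
- by rewrite rcomp0 !rdot0r mulr0.
move=> g gP; rewrite !Phi_diag ?size_plant ?forest_leaves_plant// -?stl//.
rewrite !forest_growth_plant; apply: rdot_labelings => //.
  by rewrite /strands; lia.
by rewrite mE size_growth /strands; have := leaves_gt0 s; lia.
Qed.

End VacuumCoefficient.

(** * Thompson's group *)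

Section DyadicPartitions.
Variable R : realType.
Local Open Scope ring_scope.
Implicit Types (x y u : R) (g : R -> R).

Local Notation part := (@dyadic_partition R).

Lemma size_part t x y : size (part t x y) = leaves t.
Proof. by elim: t x y => //= l IHl r IHr x y; rewrite size_cat IHl IHr. Qed.

Lemma part_affine t (c e : R) x y :
  part t (c + e * x) (c + e * y) =
  [seq (c + e * J.1, c + e * J.2) | J <- part t x y].
Proof.
elim: t x y => //= l IHl r IHr x y; rewrite map_cat -IHl -IHr.
by have -> : (c + e * x + (c + e * y)) / 2 = c + e * ((x + y) / 2) by field.
Qed.

Lemma dyadicD x y : dyadic x -> dyadic y -> dyadic (x + y).
Proof.
move=> [z [n ->]] [z' [n' ->]]; exists (z * 2 ^+ n' + z' * 2 ^+ n), (n + n')%N.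
rewrite rmorphD !rmorphM !rmorphXn /= exprD.
by field; rewrite !expf_neq0.
Qed.

Lemma dyadicM x y : dyadic x -> dyadic y -> dyadic (x * y).
Proof.
move=> [z [n ->]] [z' [n' ->]]; exists (z * z'), (n + n')%N.
by rewrite rmorphM /= exprD; field; rewrite !expf_neq0.
Qed.

Lemma dyadicXV n : dyadic (2 ^- n : R).
Proof. by exists 1, n; rewrite mul1r. Qed.

Lemma part_nth t k x y : (k < leaves t)%N -> x < y ->
  dyadic x -> dyadic y ->
  let I := nth (0, 0) (part t x y) k in
  [/\ x <= I.1, I.2 <= y, dyadic I.1 & exists d, I.2 - I.1 = (y - x) / 2 ^+ d].
Proof.
elim: t k x y => [|l IHl r IHr] k x y /=.
  by case: k => //= _ xy dx dy; split=> //; exists 0%N; rewrite expr0 divr1.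
move=> klr xy dx dy; set m := (x + y) / 2.
have [xm my] : x < m /\ m < y by rewrite /m; split; lra.
have dm : dyadic m.
  by rewrite /m; apply: dyadicM (dyadicXV 1); exact: dyadicD.
rewrite nth_cat size_part; case: ltnP => kl.
  have [h1 h2 h3 [d h4]] := IHl k x m kl xm dx dm; split=> //.
    exact: le_trans h2 (ltW my).
  by exists d.+1; rewrite h4 exprS /m; field; rewrite expf_neq0.
have kr : (k - leaves l < leaves r)%N by lia.
have [h1 h2 h3 [d h4]] := IHr _ m y kr my dm dy; split=> //.
  exact: le_trans (ltW xm) h1.
by exists d.+1; rewrite h4 exprS /m; field; rewrite expf_neq0.
Qed.

(** A single interval has to be reflected, so the subtrees off the path to the leaf are cut down to
    [Leaf] instead of being mirrored. *)
Lemma part_flip t k x y : (k < leaves t)%N ->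
  let I := nth (0, 0) (part t x y) k in
  exists t' k', (k' < leaves t')%N /\
    nth (0, 0) (part t' x y) k' = (x + y - I.2, x + y - I.1).
Proof.
elim: t k x y => [|l IHl r IHr] k x y /=.
  case: k => //= _; exists Leaf, 0%N; split=> //=; congr (_, _); ring.
move=> klr; set m := (x + y) / 2; rewrite nth_cat size_part; case: ltnP => kl.
  have [t' [k' [k't']]] := IHl k x m kl; set I := nth _ _ k => tE.
  exists (Node Leaf t'), k'.+1; split=> //=; rewrite -/m.
  (* The induction hypothesis reflects within the left half; the result is translated to the right
     half. *)
  have -> : part t' m y = part t' ((m - x) + 1 * x) ((m - x) + 1 * m).
    by congr (part _ _ _); rewrite /m; field.
  rewrite part_affine (nth_map (0, 0)) ?size_part// tE /=.
  by congr (_, _); rewrite /m; field.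
have kr : (k - leaves l < leaves r)%N by lia.
have [t' [k' [k't']]] := IHr _ m y kr; set I := nth _ _ (_ - _) => tE.
exists (Node t' Leaf), k'; split=> /=; first by lia.
rewrite -/m nth_cat size_part k't'.
have -> : part t' x m = part t' ((x - m) + 1 * m) ((x - m) + 1 * y).
  by congr (part _ _ _); rewrite /m; field.
rewrite part_affine (nth_map (0, 0)) ?size_part// tE /=.
by congr (_, _); rewrite /m; field.
Qed.

Definition maps_onto g (P Q : seq (R * R)) : Prop :=
  size P = size Q /\ forall i, (i < size P)%N ->
    let I := nth (0, 0) P i in let J := nth (0, 0) Q i in
    forall u, 0 <= u <= 1 -> g (I.1 + u * (I.2 - I.1)) = J.1 + u * (J.2 - J.1).

Lemma is_fractionP (g : thompsonF R) t s :
  maps_onto g (part s 0 1) (part t 0 1) -> is_fraction g t s.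
Proof. by rewrite /maps_onto !size_part => -[st h]; split. Qed.

Lemma maps_onto_cat g P P' Q Q' : maps_onto g P Q -> maps_onto g P' Q' ->
  maps_onto g (P ++ P') (Q ++ Q').
Proof.
move=> [sPQ h] [sPQ' h']; split; first by rewrite !size_cat sPQ sPQ'.
move=> i; rewrite size_cat !nth_cat -sPQ => ilt.
by case: (ltnP i (size P)) => iP; [exact: h|apply: h'; rewrite ltn_subLR].
Qed.

Lemma maps_onto_id g t x y : x <= y ->
  (forall u, x <= u <= y -> g u = u) -> maps_onto g (part t x y) (part t x y).
Proof.
elim: t x y => [|l IHl r IHr] x y xy gid /=.
  split=> // -[|//] _ I J u /andP[u0 u1]; rewrite /I /J /=.
  by apply: gid; apply/andP; split; nra.
by apply: maps_onto_cat; [apply: IHl|apply: IHr]; try lra;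
  move=> u /andP[u0 u1]; apply: gid; apply/andP; split; lra.
Qed.

Lemma graft_nseq t : graft (nseq (leaves t) Leaf) t = t.
Proof.
elim: t => //= l IHl r IHr.
by rewrite nseqD take_cat drop_cat size_nseq ltnn subnn take0 drop0 cats0 IHl IHr.
Qed.

Lemma take_plant n m k s : (k < n)%N -> take n (plant (n + m) k s) = plant n k s.
Proof.
move=> kn; rewrite /plant take_cat size_nseq ltnNge (ltnW kn)/=.
have -> : (n - k = (n - k.+1).+1)%N by lia.
rewrite /= take_nseq//; lia.
Qed.

Lemma drop_plant n m k s : (k < n)%N -> drop n (plant (n + m) k s) = nseq m Leaf.
Proof.
move=> kn; rewrite /plant drop_cat size_nseq ltnNge (ltnW kn)/=.
have -> : (n - k = (n - k.+1).+1)%N by lia.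
by rewrite /= drop_nseq; congr nseq; lia.
Qed.

Lemma take_plantr n m k s :
  (n <= k)%N -> take n (plant (n + m) k s) = nseq n Leaf.
Proof.
move=> nk; rewrite /plant take_cat size_nseq; case: ltnP => [nk'|kn].
  by rewrite take_nseq.
have -> : k = n by lia.
by rewrite subnn take0 cats0.
Qed.

Lemma drop_plantr n m k s :
  (n <= k)%N -> drop n (plant (n + m) k s) = plant m (k - n) s.
Proof.
move=> nk; rewrite /plant drop_cat size_nseq; case: ltnP => [nk'|kn].
  by rewrite drop_nseq; congr (_ ++ _ :: nseq _ _); lia.
have -> : k = n by lia.
by rewrite subnn drop0 /=; congr (_ :: nseq _ _); lia.
Qed.

Lemma maps_onto_plant g t k p q x y : (k < leaves t)%N -> x < y ->
  dyadic x -> dyadic y ->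
  let I := nth (0, 0) (part t x y) k in
  (forall u, (u <= I.1) || (I.2 <= u) -> g u = u) ->
  maps_onto g (part p I.1 I.2) (part q I.1 I.2) ->
  maps_onto g (part (graft (plant (leaves t) k p) t) x y)
              (part (graft (plant (leaves t) k q) t) x y).
Proof.
elim: t k x y => [|l IHl r IHr] k x y /=; first by case: k.
move=> klr xy dx dy; set m := (x + y) / 2.
have [xm my] : x < m /\ m < y by rewrite /m; split; lra.
have dm : dyadic m.
  by rewrite /m; apply: dyadicM (dyadicXV 1); exact: dyadicD.
rewrite nth_cat size_part; case: ltnP => kl gid gpq.
  rewrite !take_plant// !drop_plant// !graft_nseq.
  apply: maps_onto_cat; first exact: IHl.
  apply: maps_onto_id => [|u /andP[mu _]]; first exact: ltW.
  have [_ h _ _] := part_nth kl xm dx dm.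
  by apply: gid; apply/orP; right; exact: le_trans h mu.
have kr : (k - leaves l < leaves r)%N by lia.
rewrite !take_plantr// !drop_plantr// !graft_nseq.
apply: maps_onto_cat; last exact: IHr.
apply: maps_onto_id => [|u /andP[_ um]]; first exact: ltW.
have [h _ _ _] := part_nth kr my dm dy.
by apply: gid; apply/orP; left; exact: le_trans um h.
Qed.

Definition scale g (c e : R) x : R := c + e * g ((x - c) / e).

Lemma flip_scale g c e : e != 0 ->
  flip_fun (scale g c e) =1 scale (flip_fun g) (1 - c - e) e.
Proof.
move=> e0 x; rewrite /flip_fun /scale.
have -> : 1 - (x - (1 - c - e)) / e = (1 - x - c) / e by field.
by ring.
Qed.

Lemma maps_onto_scale g c e p q : e != 0 -> maps_onto g (part p 0 1) (part q 0 1) ->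
  maps_onto (scale g c e) (part p c (c + e)) (part q c (c + e)).
Proof.
move=> e0; have partE r : part r c (c + e) =
    [seq (c + e * J.1, c + e * J.2) | J <- part r 0 1].
  by rewrite -part_affine mulr0 addr0 mulr1.
rewrite !partE => -[sPQ h]; split; first by rewrite !size_map.
move=> i; rewrite size_map => ip; rewrite !(nth_map (0, 0)) -?sPQ// => I J u u01 /=.
rewrite /scale /I /J /=; set I0 := nth _ (part p 0 1) i; set J0 := nth _ (part q 0 1) i.
have -> : (c + e * I0.1 + u * (c + e * I0.2 - (c + e * I0.1)) - c) / e =
    I0.1 + u * (I0.2 - I0.1) by field.
by rewrite h// -/J0; ring.
Qed.

Lemma scale_id g c e x : 0 < e -> (forall u, (u <= 0) || (1 <= u) -> g u = u) ->
  (x <= c) || (c + e <= x) -> scale g c e x = x.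
Proof.
move=> e0 gid xce; have en0 : e != 0 by rewrite gt_eqF.
rewrite /scale gid; first by field.
case/orP: xce => xc; apply/orP; [left|right].
  by rewrite pmulr_lle0 ?invr_gt0// subr_le0.
by rewrite ler_pdivlMr// mul1r lerBrDl.
Qed.

Lemma thompson_scale g c d : thompson g ->
  (forall u, (u <= 0) || (1 <= u) -> g u = u) ->
  dyadic c -> 0 <= c -> c + 2 ^- d <= 1 -> thompson (scale g c (2 ^- d)).
Proof.
move=> [gout gcont ginc [B [Bd Bpw]]] gid dc c0.
have := dyadicXV d.
have : 0 < 2 ^- d :> R by rewrite invr_gt0 exprn_gt0.
move: (2 ^- d) => e e0 de ce1.
have en0 : e != 0 by rewrite gt_eqF.
split.
- move=> x; rewrite in_itv /= => xout; apply: scale_id => //.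
  by move: ce1 xout; case: (ltP x 0) => x0; case: (ltP 1 x) => x1 //=;
    rewrite ?orbT => *; apply/orP; lra.
- move=> x; apply: cvgD; first exact: cvg_cst.
  apply: cvgM; first exact: cvg_cst.
  have fc : {for x, continuous (fun x => (x - c) / e)}.
    by apply: cvgM; [apply: cvgB; [exact: cvg_id|exact: cvg_cst]|exact: cvg_cst].
  exact: (@cvg_comp _ _ _ (fun y => (y - c) / e) g _ _ _ fc (gcont _)).
- move=> x y xy; rewrite /scale ltrD2l ltr_pM2l//; apply: ginc.
  by rewrite ltr_pM2r ?invr_gt0// ltrD2r.
(* With [c] and [c + e] among the breakpoints, an interval free of breakpoints lies outside the
   copy, where the map is the identity, or inside it. *)
exists [:: c, c + e & [seq c + e * b | b <- B]]; split.
  move=> b; rewrite !inE => /or3P[/eqP->//|/eqP->|/mapP[b' /Bd db' ->]].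
    exact: dyadicD.
  by apply: dyadicD => //; exact: dyadicM.
move=> x y x0 xy y1 noB.
have cN := noB c (mem_head _ _).
have ceN : ~~ (x < c + e < y) by apply: noB; rewrite !inE eqxx orbT.
have [yc|cy] := leP y c.
  exists 0, 0 => u /andP[xu uy]; rewrite expr0z mul1r addr0; apply: scale_id => //.
  by apply/orP; left; lra.
have [cex|xce] := leP (c + e) x.
  exists 0, 0 => u /andP[xu uy]; rewrite expr0z mul1r addr0; apply: scale_id => //.
  by apply/orP; right; lra.
move: cN ceN; rewrite cy xce !(andbT, andTb) -!leNgt => cx yce.
have [||||z [d' gE]] := Bpw ((x - c) / e) ((y - c) / e).
- by apply: divr_ge0; [rewrite subr_ge0|exact: ltW].
- by rewrite ltr_pM2r ?invr_gt0// ltrD2r.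
- by rewrite ler_pdivrMr// mul1r lerBlDl.
- move=> b bB; have bN : c + e * b \in [:: c, c + e & [seq c + e * b | b <- B]].
    by rewrite !inE (map_f (fun b => c + e * b) bB) !orbT.
  apply: contra (noB _ bN); rewrite ltr_pdivrMr// ltr_pdivlMr//.
  by move=> /andP[h1 h2]; apply/andP; split; lra.
exists z, (c - 2 ^ z * c + e * d') => u /andP[xu uy].
rewrite /scale gE; first by field.
by rewrite !ler_pM2r ?invr_gt0// !lerD2r xu uy.
Qed.

End DyadicPartitions.

(** * Inequivalence *)

Section Unitary.
Variable R : realType.
Local Notation C := R[i].
Local Open Scope classical_set_scope.
Local Open Scope ring_scope.

(** The Cauchy-Schwarz inequality, by splitting [u] into its projection on [v] and an orthogonal
    part [w]. *)
Lemma hdot_le (H : hilbertSpace R) (u v : H) : `|hdot H u v| <= `|u| * `|v|.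
Proof.
rewrite -(@ler_pXn2r _ 2)// ?nnegrE ?mulr_ge0// exprMn -!hdot_norm.
have [->|v0] := eqVneq v 0; first by rewrite !linear0r normr0 expr0n.
have v1 : hdot H v v != 0 by rewrite dnorm_eq0.
pose c := hdot H u v / hdot H v v; pose w := u - c *: v.
have wv : hdot H w v = 0 by rewrite linearBl linearZl_LR /= divfK// subrr.
have -> : u = w + c *: v by rewrite subrK.
have -> : hdot H (w + c *: v) v = c * hdot H v v.
  by rewrite linearDl linearZl_LR /= wv add0r.
rewrite hnormDd; last by rewrite linearZr_LR /= wv mulr0.
rewrite [X in _ <= (_ + X) * _](_ : _ = `|c| ^+ 2 * hdot H v v); last first.
  by rewrite linearZr_LR /= linearZl_LR /= mulrCA mulrA -normCK.
rewrite normrM exprMn (ger0_norm (dnorm_ge0 _ _)) mulrDl.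
by rewrite -[X in _ <= _ + X]mulrA -expr2 lerDr mulr_ge0 ?dnorm_ge0.
Qed.

(* By continuity, a matrix coefficient of the image of [w] is approximated by
   those of the vectors of [D]. *)
Lemma not_unitarily_equivalent (P Q : unitaryRep R) (w : P) (c : C)
    (D : set Q) : c != 0 -> dense D ->
  (forall x, D x -> exists2 g, hdot P (rep_op P g w) w = c &
                               hdot Q (rep_op Q g x) x = 0) ->
  ~ unitarily_equivalent P Q.
Proof.
move=> c0 Dd hD [U [[Uiso _] Ueq]]; pose y := U w.
have norm_rep g x : `|rep_op Q g x| = `|x|.
  apply/eqP; rewrite -(@eqrXn2 _ 2)// -!hdot_norm; apply/eqP.
  by have [-> _] := rep_unitary Q g.
have c0' : 0 < `|c| by rewrite normr_gt0.
have y0 : 0 <= `|y| by [].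
(* This makes the radius [e] smaller than 1 and [e * (2 |y| + 1)] at most [|c|], in contradiction
   with the estimate of [|c|] below. *)
pose K := `|y| + `|y| + 1 + `|c|.
have K1 : 0 < `|y| + `|y| + 1 by apply: ltr_wpDl => //; exact: addr_ge0.
have K0 : 0 < K by apply: addr_gt0 => //; exact: ltr_wpDl.
pose e := `|c| / K; have e0 : 0 < e by rewrite divr_gt0.
have [x [xy Dx]] : ((ball y e)^° `&` D) !=set0.
  apply: Dd; last exact: open_interior.
  by exists y; exact: nbhsx_ballx.
have {}xy : `|y - x| < e by have := interior_subset xy; rewrite -ball_normE.
have [g gc gx] := hD x Dx; pose W := rep_op Q g.
(* [U] turns [c] into the coefficient of [W] at [y]; replacing [y] by [x] in both arguments would
   give zero. *)
have cE : c = hdot Q (W (y - x)) y + hdot Q (W x) (y - x).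
  rewrite linearBr /= gx subr0 -linearDl /= -linearD /= subrK -gc.
  by rewrite -Uiso Ueq.
have : `|c| < `|c|; last by rewrite ltxx.
have r0 : 0 <= `|y - x| by [].
apply: (@le_lt_trans _ _ (`|y - x| * (`|y| + `|y| + `|y - x|))).
  rewrite {1}cE; apply: le_trans (ler_normD _ _) _.
  apply: le_trans (lerD (hdot_le _ _) (hdot_le _ _)) _.
  rewrite !norm_rep [`|x| * _]mulrC -mulrDr ler_wpM2l// -addrA lerD2l.
  by rewrite -{1}[x](subKr y) (le_trans (ler_normB _ _)).
have e1 : e < 1 by rewrite ltr_pdivrMr// mul1r /K ltrDr.
apply: (@lt_le_trans _ _ (e * (`|y| + `|y| + 1))).
  have h : `|y| + `|y| + `|y - x| < `|y| + `|y| + 1.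
    by rewrite ltrD2l (lt_trans xy).
  by apply: ltr_pM => //; apply: addr_ge0 => //; exact: addr_ge0.
by rewrite /e mulrAC ler_pdivrMr// ler_pM2l// /K lerDl; exact: ltW.
Qed.

End Unitary.

(** * The separating element and its planted copies *)

Definition source := Node (Node Leaf (Node Leaf Leaf)) Leaf.
Definition target := Node Leaf (Node Leaf (Node Leaf Leaf)).
Definition source_mirror := Node Leaf (Node (Node Leaf Leaf) Leaf).
Definition target_mirror := Node (Node (Node Leaf Leaf) Leaf) Leaf.

Section Generator.
Variable R : realType.
Local Open Scope classical_set_scope.
Local Open Scope ring_scope.

(* Slope 2 on [0, 3/8], 1 on [3/8, 1/2] and 1/4 on [1/2, 1]. *)
Definition generator (x : R) : R :=
  x + (`|x| - `|x - 3 / 8|) / 2 - 3 / 8 * (`|x - 1 / 2| - `|x - 1|).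

(** The formula with absolute values gives continuity without gluing; the other properties are read
    off from this piecewise form. *)
Lemma generatorE x : generator x =
  if x <= 0 then x else if x <= 3 / 8 then 2 * x
  else if x <= 1 / 2 then x + 3 / 8 else if x <= 1 then x / 4 + 3 / 4 else x.
Proof.
have pos c : c <= x -> `|x - c| = x - c by move=> cx; rewrite ger0_norm ?subr_ge0.
have neg c : x <= c -> `|x - c| = c - x.
  by move=> xc; rewrite ler0_norm ?subr_le0// opprB.
have absE : `|x| = `|x - 0| by rewrite subr0.
rewrite /generator absE.
case: leP => x0; first by rewrite !neg; lra.
case: leP => x3; first by rewrite (pos 0) ?neg; lra.
case: leP => x2; first by rewrite (pos 0) ?(pos (3 / 8)) ?neg; lra.
case: leP => x1; last by rewrite !pos; lra.
by rewrite (pos 0) ?(pos (3 / 8)) ?(pos (1 / 2)) ?neg; lra.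
Qed.

Lemma generator_id x : (x <= 0) || (1 <= x) -> generator x = x.
Proof. by rewrite generatorE; do ?[case: ifP] => *; lra. Qed.

Lemma thompson_generator : thompson generator.
Proof.
split.
- move=> x; rewrite in_itv /= => xout; apply: generator_id.
  by move: xout; case: (leP 0 x); case: (leP x 1) => //= *; apply/orP; lra.
- have norm_cont (c : R) x : (fun x => `|x - c|) x @[x --> x] --> `|x - c|.
    by apply: cvg_norm; apply: cvgB; [exact: cvg_id|exact: cvg_cst].
  move=> x; rewrite /continuous_at /generator.
  have n0 : (fun x : R => `|x|) x @[x --> x] --> `|x| by apply: cvg_norm; exact: cvg_id.
  apply: cvgB; last first.
    apply: cvgM; first exact: cvg_cst.
    exact: cvgB (norm_cont _ _) (norm_cont _ _).
  apply: cvgD; first exact: cvg_id.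
  by apply: cvgM; [exact: cvgB n0 (norm_cont _ _)|exact: cvg_cst].
- by move=> x y xy; rewrite !generatorE; do ?[case: ifP] => *; lra.
exists [:: 3 / 8; 1 / 2]; split.
  move=> c; rewrite !inE => /orP[] /eqP->; first by exists 3, 3%N; lra.
  by exists 1, 1%N; lra.
move=> x y x0 xy y1 noB.
have : ~~ (x < 3 / 8 < y) by apply: noB; rewrite !inE eqxx.
have : ~~ (x < 1 / 2 < y) by apply: noB; rewrite !inE eqxx orbT.
rewrite !negb_and -!leNgt => x2 x3.
have [y3|y3] := leP y (3 / 8).
  exists 1, 0 => u /andP[xu uy]; rewrite expr1z generatorE.
  by do ?[case: ifP] => *; lra.
have {}x3 : 3 / 8 <= x by move: x3 => /orP[]; lra.
have [y2|y2] := leP y (1 / 2).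
  exists 0, (3 / 8) => u /andP[xu uy]; rewrite expr0z generatorE.
  by do ?[case: ifP] => *; lra.
have {}x2 : 1 / 2 <= x by move: x2 => /orP[]; lra.
exists (- 2), (3 / 4) => u /andP[xu uy]; rewrite -exprnN expr2 generatorE.
by do ?[case: ifP] => *; lra.
Qed.

Lemma generator_maps_onto :
  maps_onto generator (dyadic_partition source 0 1) (dyadic_partition target 0 1).
Proof.
split=> // -[|[|[|[|//]]]] _ I J u /andP[u0 u1]; rewrite /I /J /= generatorE;
  by do ?[case: ifP] => *; lra.
Qed.

Lemma flip_generator_maps_onto : maps_onto (flip_fun generator)
  (dyadic_partition source_mirror 0 1) (dyadic_partition target_mirror 0 1).
Proof.
split=> // -[|[|[|[|//]]]] _ I J u /andP[u0 u1];
  rewrite /I /J /flip_fun /= generatorE; by do ?[case: ifP] => *; lra.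
Qed.

Lemma eq_maps_onto (g h : R -> R) P Q : g =1 h -> maps_onto g P Q -> maps_onto h P Q.
Proof.
by move=> gh [sPQ hg]; split=> // i iP I J u u01; rewrite -gh; exact: hg.
Qed.

(* [g] acts as [generator] inside the leaf [k'] of [t'], and its mirror image
   acts as the mirror image of [generator] inside the leaf [k] of [t]. *)
Lemma planted_generator t k : (k < leaves t)%N ->
  exists (g : thompsonF R) t' k',
    let graft_at t k s := graft (plant (leaves t) k s) t in
    [/\ (k' < leaves t')%N,
        is_fraction g (graft_at t' k' target) (graft_at t' k' source) &
        is_fraction (sigmaF g)
          (graft_at t k target_mirror) (graft_at t k source_mirror)].
Proof.
move=> kt; have d0 : dyadic (0 : R) by exists 0, 0%N; rewrite mul0r.
have d1 : dyadic (1 : R) by exists 1, 0%N; rewrite divr1.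
have [t' [k' [k't' I'E]]] := part_flip (0 : R) 1 kt.
have [] := part_nth kt (ltr01 : (0 : R) < 1) d0 d1.
set I := nth _ _ k => I0 I1 dI [d].
rewrite subr0 mul1r => dE; rewrite -/I in I'E.
have [] := part_nth k't' (ltr01 : (0 : R) < 1) d0 d1.
(* [c] is the left end of the reflected interval, so the copy of [generator] starting there fills
   the leaf [k'] of [t']. *)
rewrite I'E /= add0r => c0 c1 dc _; set c := 1 - I.2 in c0 c1 dc I'E.
have e0 : 0 < 2 ^- d :> R by rewrite invr_gt0 exprn_gt0.
have en0 : 2 ^- d != 0 :> R by rewrite gt_eqF.
have cE : c + 2 ^- d = 1 - I.1 by rewrite -dE /c; ring.
have ce1 : c + 2 ^- d <= 1 by rewrite cE; lra.
have gT := thompson_scale thompson_generator generator_id dc c0 ce1.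
exists (ThompsonF gT), t', k'; split=> //; apply: is_fractionP.
  apply: maps_onto_plant => //; rewrite I'E add0r -/c -cE.
    by move=> u; apply: scale_id => //; exact: generator_id.
  exact: (maps_onto_scale c en0 generator_maps_onto).
apply: (@eq_maps_onto (scale (flip_fun generator) I.1 (2 ^- d))).
  move=> x; rewrite /= flip_scale//; congr (scale _ _ _ _); lra.
have I2E : I.2 = I.1 + 2 ^- d by rewrite -dE; ring.
apply: maps_onto_plant => //; rewrite -/I I2E.
  move=> u; apply: scale_id => // v v01; rewrite /flip_fun generator_id; first by ring.
  by case/orP: v01 => v01; apply/orP; [right|left]; lra.
exact: (maps_onto_scale _ en0 flip_generator_maps_onto).
Qed.

End Generator.

(** * Values of the vacuum coefficients *)

Section Coefficients.
Variable R : realType.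
Local Notation C := R[i].
Local Open Scope ring_scope.

Lemma vacuum_coef_gt0 (delta a b : R) w w' : 0 < delta -> 0 < a -> 0 < b ->
  (0 < size (pairing_terms w w'))%N ->
  vacuum_coef delta%:C%C a%:C%C b%:C%C w w' != 0.
Proof.
move=> d0 a0 b0 sz; rewrite gt_eqF// /vacuum_coef.
have term_gt0 (t : nat * nat * option nat) :
    0 < a%:C%C ^+ t.1.1 * b%:C%C ^+ t.1.2 * delta%:C%C ^+ odflt 0%N t.2 :> C.
  by rewrite !mulr_gt0// exprn_gt0// ltcR.
case: (pairing_terms w w') sz => // t l _; rewrite big_cons ltr_pwDl//.
by apply: sumr_ge0 => t' _; exact: ltW.
Qed.

(* The value of [a ^+ x * b ^+ y * delta ^+ k] if [delta = a ^+ 2],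
   [b = - a^-1] and [a ^+ 4 = 2], for [x + y = 6]. *)
Definition ising_term (t : nat * nat * option nat) : int :=
  let: (x, y, k) := t in (-1) ^+ y * 2 ^+ ((3 + odflt 0%N k - y)./2).

(** Two trees with four leaves have six branchings together. The bound and the parity ensure that
    the term is an integer, so the sum can be evaluated in [int]. *)
Definition ising_check (t : nat * nat * option nat) : bool :=
  let: (x, y, k) := t in
  [&& x + y == 6, y <= 3 + odflt 0 k & ~~ odd (3 + odflt 0 k - y)]%N.

Lemma ising_vacuum_coef (delta a b : C) w w' z :
  a ^+ 4 = 2 -> delta = a ^+ 2 -> b = - a^-1 ->
  all ising_check (pairing_terms w w') ->
  foldr (fun t s => ising_term t + s) 0 (pairing_terms w w') = z ->
  vacuum_coef delta a b w w' = z%:~R.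
Proof.
move=> a4 -> -> + <-; have a0 : a != 0.
  by apply: contra_eq_neq a4 => ->; rewrite expr0n eq_sym pnatr_eq0.
rewrite /vacuum_coef; elim: (pairing_terms w w') => [|[[x y] k] l IHl] /=.
  by rewrite big_nil.
case/andP=> /and3P[/eqP xy yk ev] /IHl{}IHl; rewrite big_cons IHl rmorphD /=.
congr (_ + _); rewrite rmorphM !rmorphXn /= rmorphN1 -[2%:~R]/(2 : C) -a4 -!exprM.
move: (odflt 0%N k) yk ev => {}k yk ev; set m := (_ - y)./2.
have mE : (3 + k - y = m.*2)%N by rewrite -[LHS]odd_double_half (negPf ev).
(* Compares exponents of [a]: the factor [delta ^+ k] contributes [2 * k], [b ^+ y] contributes
   [- y], and [2 ^+ m] is [a ^+ (4 * m)]. *)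
have xE : (x + 2 * k = 4 * m + y)%N by lia.
have -> : a ^+ (4 * m) = a ^+ (x + 2 * k) / a ^+ y.
  by rewrite xE exprD mulfK// expf_neq0.
rewrite exprNn exprVn exprD.
by move: (a ^+ x) (a ^+ (2 * k)) ((-1) ^+ y) ((a ^+ y)^-1) => ? ? ? ?; ring.
Qed.

(** Both side conditions are evaluated over the 64 pairs of words, eight for each tree. *)
Lemma ising_vacuum_coef0 (delta a b : C) :
  a ^+ 4 = 2 -> delta = a ^+ 2 -> b = - a^-1 ->
  vacuum_coef delta a b (growth 0 source_mirror) (growth 0 target_mirror) = 0.
Proof.
by move=> h1 h2 h3; rewrite (ising_vacuum_coef h1 h2 h3 (z := 0)).
Qed.

Lemma ising_vacuum_coef1 (delta a b : C) :
  a ^+ 4 = 2 -> delta = a ^+ 2 -> b = - a^-1 ->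
  vacuum_coef delta a b (growth 0 source) (growth 0 target) = 1.
Proof.
by move=> h1 h2 h3; rewrite (ising_vacuum_coef h1 h2 h3 (z := 1)).
Qed.

End Coefficients.

(** * Matrix coefficients of a Jones representation *)

Section JonesRepresentations.
Variable R : realType.
Local Notation C := R[i].
Local Open Scope classical_set_scope.
Local Open Scope ring_scope.

(** [V v] is the image of the copy indexed by [v], and [w] is the vacuum vector. This is all that
    the comparison uses of a Jones representation. *)
Lemma jones_coefficients (delta a b : R) (P : unitaryRep R) : delta != 0 ->
  is_jones_rep delta a%:C%C b%:C%C P ->
  exists (V : tree -> set P) (w : P),
  [/\ dense [set x | exists v, V v x], hdot P w w != 0, forall v, V v w &
      forall v k s t g x, (k < leaves v)%N ->
        pairable (growth 0 s) (growth 0 t) ->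
        is_fraction g (graft (plant (leaves v) k t) v)
                      (graft (plant (leaves v) k s) v) ->
        V v x ->
        hdot P (rep_op P g x) x =
        vacuum_coef delta%:C%C a%:C%C b%:C%C (growth 0 s) (growth 0 t) *
        hdot P x x].
Proof.
move=> delta0 [j [_ jdot jlim jdense jact]].
pose V v := [set x : P |
  exists2 xi, Phi_span delta a%:C%C b%:C%C xi & j v xi = x].
(* The vacuum vector is the single strand over the trivial tree; the connecting map of the forest
   [[:: v]] carries it into the copy of any [v]. *)
pose one : Rec R 1 (strands (leaves Leaf)) := diag R 1 1 id_code.
have one_span : Phi_span delta a%:C%C b%:C%C (n := leaves Leaf) one.
  exists [:: (1, Leaf)]; split=> //; rewrite big_seq1 /= scale1r Phi_labelings//.
exists V, (j Leaf one); split=> //.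
- rewrite jdot// [X in X != 0](rdot_diag delta (planar_id 1) (planar_id 1)).
  by rewrite expf_neq0// fmorph_eq0.
- move=> v; exists (rcomp delta (Phi delta a%:C%C b%:C%C 1 (leaves v) [:: v]) one).
    by apply: Phi_span_Phi => //; rewrite /forest_leaves /= addn0.
  exact: (jlim Leaf [:: v] one erefl one_span).
move=> v k s t g _ kv st gts [xi xis <-].
have [stl _] := gts.
set T := graft _ _ in gts stl; set S := graft _ _ in gts stl.
have TE : leaves T = ((leaves v).-1 + leaves t)%N.
  by rewrite leaves_graft ?size_plant// forest_leaves_plant.
have SE : leaves S = ((leaves v).-1 + leaves s)%N.
  by rewrite leaves_graft ?size_plant// forest_leaves_plant.
(* [S] is [v] with [s] planted on it, so the forest over [S] is trivial and [g] takes [xi] to the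
   image of [plant s] in the copy of [T]. *)
have := jact g T S gts v (nseq (leaves S) Leaf) (plant (leaves v) k s) xi.
have -> : graft (nseq (leaves S) Leaf) T = T by rewrite -stl graft_nseq.
rewrite size_nseq size_plant// graft_nseq => /(_ erefl erefl erefl xis) ->.
(* The second argument is moved to the copy of [T] as well, through [plant t]; the coefficient is
   then an inner product in one space. *)
rewrite -{1}(jlim v (plant (leaves v) k t) xi (size_plant _ kv) xis).
rewrite -/T !jdot//; last 2 first.
- by apply: Phi_span_Phi => //; rewrite ?size_plant// forest_leaves_plant// -SE.
- by apply: Phi_span_Phi => //; rewrite ?size_plant// forest_leaves_plant.
by apply: rdot_plant => //; rewrite -SE.
Qed.

End JonesRepresentations.

Local Open Scope ring_scope.
Local Open Scope complex_scope.

Theorem corollary4p6 (R : realType) (delta : R)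
  (hdelta : (exists2 k : nat, (4 <= k)%N & delta = 2 * cos (pi / k%:R)) \/
            2 <= delta)
  (a : R) (ha : a = (2 + 2 * delta) `^ (- (1 / 2)))
  (P : unitaryRep R) (hP : is_jones_rep delta a%:C a%:C P)
  (Q : unitaryRep R)
  (hQ : is_jones_rep (Num.sqrt 2) (2 `^ (1 / 4))%:C
           (- 2 `^ (- (1 / 4)))%:C Q) :
  [/\ ~ unitarily_equivalent P Q,
      ~ unitarily_equivalent P (rep_sigma Q)
    & ~ unitarily_equivalent Q (rep_sigma Q)].
Proof.
have d0 : 0 < delta.
  case: hdelta => [[k k4 ->]|]; last by lra.
  have k0 : (0 < k%:R :> R) by rewrite ltr0n; lia.
  have pi0 := pi_gt0 R.
  rewrite mulr_gt0// cos_gt0_pihalf//; apply/andP; split.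
    by apply: (@lt_trans _ _ 0); [lra|exact: divr_gt0].
  by rewrite ltr_pM2l// ltf_pV2 ?posrE// ltr_nat; lia.
have a0 : 0 < a by rewrite ha powR_gt0//; lra.
have sqrt2_0 : Num.sqrt 2 != 0 :> R by rewrite gt_eqF// sqrtr_gt0.
have [VP [wP [_ wP0 VwP coefP]]] := jones_coefficients (lt0r_neq0 d0) hP.
have [VQ [wQ [denseQ wQ0 VwQ coefQ]]] := jones_coefficients sqrt2_0 hQ.
set c := 2 `^ (1 / 4) in hQ coefQ.
have c4 : (c%:C : R[i]) ^+ 4 = 2.
  rewrite -rmorphXn /c -powR_mulrn ?powR_ge0// -powRrM.
  have -> : 1 / 4 * 4%:R = 1 :> R by field.
  by rewrite powRr1// rmorph_nat.
have c2 : ((Num.sqrt 2)%:C : R[i]) = c%:C ^+ 2.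
  rewrite -rmorphXn /c -powR_mulrn ?powR_ge0// -powRrM -powR12_sqrt//.
  by congr ((_ `^ _)%:C); field.
have cV : ((- 2 `^ (- (1 / 4)))%:C : R[i]) = - c%:C^-1.
  by rewrite powRN -/c rmorphN fmorphV.
have vac0 := ising_vacuum_coef0 c4 c2 cV.
have vac1 := ising_vacuum_coef1 c4 c2 cV.
have pair1 : pairable (growth 0 source) (growth 0 target) by [].
have pair2 : pairable (growth 0 source_mirror) (growth 0 target_mirror) by [].
have vacP w w' : (0 < size (pairing_terms w w'))%N ->
    vacuum_coef delta%:C a%:C a%:C w w' * hdot P wP wP != 0.
  by move=> ww'; rewrite mulf_neq0// vacuum_coef_gt0.
(* Leaf 0 is used because every tree has it. *)
have Q0 v x g : VQ v x ->
    is_fraction g (graft (plant (leaves v) 0 target_mirror) v)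
      (graft (plant (leaves v) 0 source_mirror) v) ->
    hdot Q (rep_op Q g x) x = 0.
  move=> vx gv; rewrite (coefQ v 0%N source_mirror target_mirror)//.
    by rewrite vac0 mul0r.
  exact: leaves_gt0.
split.
(* The element acting is [sigmaF g]: its mirrored trees, planted in [v], give zero in [Q] and a
   positive coefficient in [P]. *)
- apply: (not_unitarily_equivalent (w := wP) (vacP (growth 0 source_mirror)
    (growth 0 target_mirror) isT) denseQ) => x [v vx].
  have [g [_ [_ [_ _ gv]]]] := planted_generator R (leaves_gt0 v).
  exists (sigmaF g); last exact: Q0 vx gv.
  by apply: coefP gv _ => //; exact: leaves_gt0.
(* In [rep_sigma Q] the element [g] acts as [sigmaF g], planted in [v], while in [P] it acts as the
   fraction planted in [t']; the vacuum vector [wP] belongs to the copies of both trees. *)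
- apply: (not_unitarily_equivalent (w := wP) (Q := rep_sigma Q) (vacP
    (growth 0 source) (growth 0 target) isT) denseQ) => x [v vx].
  have [g [t' [k' [k't' gt' gv]]]] := planted_generator R (leaves_gt0 v).
  by exists g; [exact: coefP gt' _|exact: Q0 vx gv].
(* The coefficient 1 of the unmirrored fraction at the vacuum vector is set against the coefficient
   0 of its mirror image. *)
- apply: (not_unitarily_equivalent (w := wQ) (Q := rep_sigma Q) wQ0 denseQ).
  move=> x [v vx].
  have [g [t' [k' [k't' gt' gv]]]] := planted_generator R (leaves_gt0 v).
  exists g; last exact: Q0 vx gv.
  by rewrite (coefQ _ _ _ _ _ _ k't' pair1 gt')// vac1 mul1r.
Qed.
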